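(* Let $m_1,m_2,n$ be integers with $0 < m_2 \leq m_1 \leq n m_2$. The log-likelihood $\ell_Y$ of the matrix normal model is unbounded from above for every tuple of samples $Y \in (\mathbb{R}^{m_1 \times m_2})^n$ if and only if there exists $k \in \{1,\ldots,m_2\}$ such that $l = \lceil \frac{m_1}{m_2}k\rceil - 1$ satisfies both $$m_1 - l \leq n(m_2-k) \quad\text{and}\quad \mathrm{cp}^{(n)}(a,b,c,d) = cd, \quad\text{where } (a,b,c,d) = (m_2-k,\,k,\,m_1-l,\,nk-l).$$
   Context: $\mathrm{PD}_m$ is the cone of real symmetric positive definite $m\times m$ matrices. For $Y=(Y_1,\dots,Y_n)\in(\mathbb{R}^{m_1\times m_2})^n$, the log-likelihood of the (real) matrix normal model is the function on $\mathrm{PD}_{m_1}\times\mathrm{PD}_{m_2}$ $$\ell_Y(\Psi_1,\Psi_2)=m_2\log\det(\Psi_1)+m_1\log\det(\Psi_2)-\frac1n\mathrm{tr}\Big(\Psi_1\sum_{i=1}^nY_i\Psi_2Y_i^{\mathsf T}\Big).$$ Cut-and-paste rank: for positive integers $a,b,c,d,n$, $\mathrm{cp}^{(n)}(a,b,c,d)$ is the maximum rank of the $cd\times ab$ matrix $\sum_{i=1}^n X_i\otimes Z_i$ (Kronecker products), as $X_i$ and $Z_i$ range over real matrices of sizes $c\times a$ and $d\times b$ respectively. (When $k=m_2$, so that $a=0$, the first condition $m_1-l\le n(m_2-k)$ already fails, so the cut-and-paste rank is only needed for positive arguments.) *)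

(* Defs.v *)
From mathcomp Require Export all_boot all_order all_algebra.
From mathcomp Require Export mxtens.
From mathcomp Require Export boolp classical_sets reals exp.

Set Implicit Arguments.
Unset Strict Implicit.
Unset Printing Implicit Defensive.

Import Order.TTheory GRing.Theory Num.Theory.

Local Open Scope ring_scope.
Local Open Scope classical_set_scope.

Definition PD (R : realType) (m : nat) : set 'M[R]_m :=
  [set A | A^T = A /\
     forall v : 'cV[R]_m, v != 0 -> 0 < (v^T *m A *m v) ord0 ord0].
Arguments PD : clear implicits.

Definition loglik (R : realType) (m1 m2 n : nat) (Y : 'I_n -> 'M[R]_(m1, m2))
    (Psi1 : 'M[R]_m1) (Psi2 : 'M[R]_m2) : R :=
  m2%:R * ln (\det Psi1) + m1%:R * ln (\det Psi2)
  - n%:R^-1 * \tr (Psi1 *m \sum_(i < n) (Y i *m Psi2 *m (Y i)^T)).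

Definition loglik_unbounded (R : realType) (m1 m2 n : nat)
    (Y : 'I_n -> 'M[R]_(m1, m2)) : Prop :=
  ~ has_ubound [set loglik Y Psi1 Psi2 | Psi1 in PD R m1 & Psi2 in PD R m2].

(* The rank of a (c * d) x (a * b) matrix is at most c * d, so bounding the
   index set of the maximum by c * d discards no attained rank. *)
Definition cp (R : realType) (n a b c d : nat) : nat :=
  \max_(r < (c * d).+1 |
      `[< exists (X : 'I_n -> 'M[R]_(c, a)) (Z : 'I_n -> 'M[R]_(d, b)),
            \rank (\sum_(i < n) (X i *t Z i))%R = r :> nat >]) r.

(* Main.v *)
Require Import Defs.
From mathcomp Require multinomials.mpoly.
From mathcomp Require Import sequences topology normedtype derive.
From mathcomp Require Import perm.
From mathcomp Require Import zify ring lra.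
Import (canonicals, coercions, hints) multinomials.mpoly.
Import numFieldNormedType.Exports.

(** A tuple Y of m1 x m2 matrices is called expanding when every subspace V
    of R^m2 satisfies m1 * dim V <= m2 * dim (sum_i Y_i V).  Both sides of the
    criterion say that no tuple is expanding.

    Likelihood.  If V of dimension k has image W of dimension l with
    m2 * l < m1 * k, let Psi2 grow like s on V and Psi1 shrink like 1/s on W:
    the trace stays bounded while the log-determinants contribute
    (m1 k - m2 l) ln s, so the likelihood is unbounded
    ([not_expanding_unbounded]).  Conversely let Y be expanding.  Pivoted LDL
    writes Psi1 = u diag(mu) u^T and Psi2 = v diag(lam) v^T with u, v in a
    compact set, and the trace is then the sum of mu_a lam_j w_aj with
    w_aj = sum_i (u^T Y_i v)_aj^2.  Expansion is Hall's condition for the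
    bipartite graph w_aj > 0 with m1 copies of each j and m2 copies of each a,
    so the log-determinants are the sum of the logarithms of the products
    mu_a lam_j along a perfect matching, and each logarithm is dominated by the
    trace term of its product.  Compactness makes the constants uniform ([expanding_bounded]).

    Certificates.  Expansion quantifies over all subspaces.  It is turned into
    an open algebraic condition by blowing up: if V violates expansion then for
    all T_i of size m2 N x m1 N the map K |-> sum_i T_i K Y_i^T has a kernel of
    dimension at least N ([corank_ge]), while an expanding tuple admits, for
    some N, matrices T_i with a kernel of dimension less than N
    ([expanding_corank_small]).  This approximate form of the theorem on the
    noncommutative rank holds over every infinite field; it lets one move
    between a tuple, nearby tuples and tuples of rational functions.

    Genericity.  Let l be the largest integer with m2 l < m1 k.  That the
    cut-and-paste rank for k is full means that for some P_i (l x k) and X_i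
    ((m1 - l) x (m2 - k)) the map (u, w) |-> (u P_i + X_i w)_i is onto
    ([tens_tangent_onto]): at the block diagonal tuple Y1 with blocks P_i, X_i
    the tuples having a k-dimensional subspace with image of dimension at most
    l fill all directions to first order.  By a Hensel argument, on the line
    from Y1 to any Y the block triangular form persists modulo t^M for all M; a
    certificate of expansion for Y would yield a polynomial in t that is divisible by all
    powers of t and nonzero at t = 1.  So no tuple is expanding
    ([tangent_onto_not_expanding]).  Conversely, if no real tuple is expanding,
    the tuple of independent indeterminates is not expanding over the rational
    functions, because a certificate would specialize
    ([generic_not_expanding]).  Its violating subspace gives polynomial
    matrices C and B with C Y_i B^T = 0; differentiating this identity with
    respect to every entry of Y at a good point shows, by duality, that the
    cut-and-paste rank is full ([not_expanding_tens]). *)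

Set Implicit Arguments.
Unset Strict Implicit.
Unset Printing Implicit Defensive.

Import Order.TTheory GRing.Theory Num.Theory.

Local Open Scope ring_scope.

(** * Linear algebra over fields with enough elements *)

(** The only form in which a field is required to be infinite: it is what
    choosing a generic parameter on a line uses, and it holds for function
    fields as well as for the reals. *)
Definition has_nonroots (F : fieldType) :=
  forall P : {poly F}, P != 0 -> exists s, P.[s] != 0.

Lemma pchar0_has_nonroots (F : fieldType) : [pchar F] =i pred0 -> has_nonroots F.
Proof.
move=> F0 P P0.
pose rs := [seq i%:R | i <- iota 0 (size P)] : seq F.
have urs : uniq rs.
  rewrite map_inj_in_uniq ?iota_uniq // => i j _ _ /eqP.
  wlog lij : i j / (i <= j)%N.
    by move=> H; case/orP: (leq_total i j) => h E; [|symmetry]; apply: H h _ => //; rewrite eq_sym.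
  rewrite eq_sym -subr_eq0 -natrB // (pcharf0P _).1 // subn_eq0 => lji.
  by apply/eqP; rewrite eqn_leq lij.
have [/(max_poly_roots P0) H|/allPn[s _ Ps]] := boolP (all (root P) rs).
  by move: (H urs); rewrite size_map size_iota ltnn.
by exists s.
Qed.

Section LinearAlgebra.
Variable F : fieldType.

Lemma map_horner_polyC (s : F) k l (A : 'M[F]_(k, l)) :
  map_mx (horner_eval s) (map_mx polyC A) = A.
Proof. by rewrite -map_mx_comp map_mx_id // => y /=; rewrite /horner_eval hornerC. Qed.

(** Full-rank minors in the form that survives deformation: instead of
    selecting rows and columns, multiply by constant matrices on both sides. *)
Lemma rank_corner m n (A : 'M[F]_(m, n)) :
  exists (R : 'M_(\rank A, m)) (C : 'M_(n, \rank A)), R *m A *m C = 1%:M.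
Proof.
exists (pinvmx (col_base A)), (pinvmx (row_base A)).
transitivity (pinvmx (col_base A) *m (col_base A *m row_base A) *m pinvmx (row_base A)).
  by rewrite mulmx_base.
by rewrite mulmxA mulVpmx ?col_base_full // mul1mx mulmxVp // row_base_free.
Qed.

Lemma rank_corner_det m n r (A : 'M[F]_(m, n)) (R : 'M_(r, m)) (C : 'M_(n, r)) :
  \det (R *m A *m C) != 0 -> (r <= \rank A)%N.
Proof.
rewrite -unitfE -[_ \is a _]/(_ \in unitmx) -row_full_unit -col_leq_rank => h.
by apply: leq_trans h _; rewrite (leq_trans (mxrankM_maxl _ _)) // mxrankM_maxr.
Qed.

(** Rank is lower semicontinuous: the determinant of R M(s) C, for R and C
    exhibiting the rank at s0, is a polynomial in s that does not vanish at
    s0. *)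
Lemma rank_eval_generic m n (M : 'M[{poly F}]_(m, n)) (s0 : F) :
  exists2 P : {poly F}, P.[s0] != 0 &
    forall s, P.[s] != 0 ->
      (\rank (map_mx (horner_eval s0) M) <= \rank (map_mx (horner_eval s) M))%N.
Proof.
have [R [C RC]] := rank_corner (map_mx (horner_eval s0) M).
pose P := \det (map_mx polyC R *m M *m map_mx polyC C).
have PE s : P.[s] = \det (R *m map_mx (horner_eval s) M *m C).
  by rewrite -horner_evalE -det_map_mx !map_mxM !map_horner_polyC.
exists P; first by rewrite PE RC det1 oner_eq0.
by move=> s; rewrite PE => /rank_corner_det.
Qed.

Lemma rank_line_generic m n (A B : 'M[F]_(m, n)) (s0 : F) :
  exists2 P : {poly F}, P.[s0] != 0 &
    forall s, P.[s] != 0 -> (\rank (A + s0 *: B)%R <= \rank (A + s *: B)%R)%N.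
Proof.
have E s : map_mx (horner_eval s) (map_mx polyC A + 'X *: map_mx polyC B) = A + s *: B.
  by apply/matrixP => i j; rewrite !mxE /horner_eval hornerD hornerM hornerX !hornerC.
have [P P0 H] := rank_eval_generic (map_mx polyC A + 'X *: map_mx polyC B) s0.
exists P; first exact: P0.
by move=> s Ps; have := H s Ps; rewrite !E.
Qed.

(** Two operators need not reach their largest ranks at the same parameter;
    a general point of the joining line is as good as the left end for the
    first and as the right end for the second. *)
Lemma rank_line_join m n m' n' (A B : 'M[F]_(m, n)) (A' B' : 'M[F]_(m', n')) :
  has_nonroots F ->
  exists s, (\rank A <= \rank (A + s *: (B - A))%R)%N /\
            (\rank B' <= \rank (A' + s *: (B' - A'))%R)%N.
Proof.
move=> Finf.
have [P P0 HP] := rank_line_generic A (B - A) 0.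
have [Q Q0 HQ] := rank_line_generic A' (B' - A') 1.
have PQ0 : P * Q != 0.
  by rewrite mulf_neq0 //; [apply: contraNneq P0 | apply: contraNneq Q0] => ->; rewrite horner0.
case: (Finf _ PQ0) => s.
rewrite hornerM mulf_eq0 negb_or => /andP[/HP h /HQ h']; exists s.
by move: h h'; rewrite scale0r addr0 scale1r addrCA subrr addr0.
Qed.

(** First-order condition at a matrix A of maximal rank in a pencil.  Bordering
    an invertible corner of A by u and v, the determinant of the bordered
    corner of A + s B is s times a polynomial whose value at 0 is u B v. *)
Lemma max_rank_first_order m n (A B : 'M[F]_(m, n)) (u : 'rV_m) (v : 'cV_n) :
  has_nonroots F -> (forall s, \rank (A + s *: B)%R <= \rank A)%N ->
  u *m A = 0 -> A *m v = 0 -> u *m B *m v = 0.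
Proof.
move=> Finf maxA uA Av.
have [R [C RC]] := rank_corner A.
(* N s is the bordered corner of A + s B with its last row divided by s, which is
   possible because u A = 0; it stays polynomial in s, and N 0 is triangular. *)
pose N s := block_mx (1%:M + s *: (R *m B *m C)) (s *: (R *m B *m v))
                     (u *m B *m C) (u *m B *m v).
have NE s : s != 0 -> N s = col_mx R (s^-1 *: u) *m (A + s *: B) *m row_mx C v.
  move=> s0; rewrite mul_col_mx mul_col_row !mulmxDr !mulmxDl RC.
  rewrite -!scalemxAl -!scalemxAr -!scalemxAl uA -[R *m A *m v]mulmxA Av.
  by rewrite !mul0mx !mulmx0 !scaler0 !add0r !scalerA mulVf // !scale1r.
pose NX := block_mx (1%:M + 'X *: map_mx polyC (R *m B *m C)) ('X *: map_mx polyC (R *m B *m v))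
                     (map_mx polyC (u *m B *m C)) (map_mx polyC (u *m B *m v)).
have NXE s : (\det NX).[s] = \det (N s).
  rewrite -horner_evalE -det_map_mx map_block_mx map_mxD map_mx1 !map_mxZ !map_horner_polyC.
  by rewrite /= /horner_eval hornerX.
have [//|nz] := eqVneq (u *m B *m v) 0.
have N0 : (\det NX).[0] != 0.
  rewrite NXE /N !scale0r addr0 det_lblock det1 mul1r.
  by apply: contra_neq nz => d0; apply/matrixP => i j; rewrite !ord1 -det_mx11 d0 mxE.
have XN0 : 'X * \det NX != 0.
  by rewrite mulf_neq0 ?polyX_eq0 //; apply: contraNneq N0 => ->; rewrite horner0.
case: (Finf _ XN0) => s.
rewrite hornerM hornerX mulf_eq0 negb_or NXE => /andP[s0].
rewrite NE // => /rank_corner_det h.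
by move: (leq_trans h (maxA s)); rewrite addn1 ltnn.
Qed.

(** A space is no larger than its image under g plus what g kills; the second
    part is measured through h, injective on the kernel of g. *)
Lemma rank_le_split p N N1 N2 d1 d2 (U : 'M[F]_(p, N)) (g : 'M_(N, N1)) (h : 'M_(N, N2))
    (D1 : 'M_(d1, N1)) (D2 : 'M_(d2, N2)) :
  (forall u : 'rV_N, (u <= U)%MS -> (u *m g <= D1)%MS) ->
  (forall u : 'rV_N, (u <= U)%MS -> u *m g = 0 -> (u *m h <= D2)%MS) ->
  (forall u : 'rV_N, u *m g = 0 -> u *m h = 0 -> u = 0) ->
  (\rank U <= \rank D1 + \rank D2)%N.
Proof.
move=> Hg Hh Hinj; rewrite -(mxrank_mul_ker U g) leq_add //.
  apply: mxrankS; apply/row_subP => i; rewrite row_mul; apply: Hg; exact: row_sub.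
set V := (U :&: kermx g)%MS.
have VU : (V <= U)%MS by exact: capmxSl.
have Vg (u : 'rV_N) : (u <= V)%MS -> u *m g = 0.
  by move=> uV; apply/sub_kermxP/(submx_trans uV)/capmxSr.
rewrite -(mxrank_mul_ker V h) (_ : \rank (V :&: kermx h)%MS = 0%N) ?addn0.
  apply: mxrankS; apply/row_subP => i; rewrite row_mul; apply: Hh; last by apply/Vg/row_sub.
  exact: submx_trans (row_sub _ _) VU.
apply/eqP; rewrite mxrank_eq0 -submx0; apply/rV_subP => u; rewrite sub_capmx => /andP[/Vg ug uh].
by rewrite (Hinj u ug) ?sub0mx //; apply/sub_kermxP.
Qed.

Lemma rank_col_ge r1 r2 N N1 (A : 'M[F]_(r1, N)) (B : 'M_(r2, N)) (g : 'M_(N, N1)) :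
  B *m g = 0 -> (\rank (A *m g) + \rank B <= \rank (col_mx A B))%N.
Proof.
move=> Bg; rewrite -(mxrank_mul_ker (col_mx A B) g) leq_add //.
  by rewrite mul_col_mx Bg; apply: mxrankS; rewrite -addsmxE addsmxSl.
apply: mxrankS; rewrite sub_capmx -addsmxE addsmxSr /=; exact/sub_kermxP.
Qed.

Lemma exists_free_rows s N (A : 'M[F]_(s, N)) c :
  (c <= \rank A)%N -> exists2 C : 'M_(c, N), row_free C & (C <= A)%MS.
Proof.
move=> cA; exists ((pid_mx c : 'M_(c, \rank A)) *m row_base A).
  by rewrite /row_free mxrankMfree ?row_base_free // rank_pid_mx.
by rewrite (submx_trans (submxMl _ _)) // eq_row_base.
Qed.

End LinearAlgebra.

(** Divisibility of the difference by x is read off the polynomial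
    det (A + X B), whose constant term is det A. *)
Lemma det_line (R : comNzRingType) r (A B : 'M[R]_r) (x : R) :
  exists y, \det (A + x *: B) = \det A + x * y.
Proof.
pose p : {poly R} := \det (map_mx polyC A + 'X *: map_mx polyC B).
have pE s : p.[s] = \det (A + s *: B).
  rewrite -horner_evalE -det_map_mx; congr determinant.
  by apply/matrixP => i j; rewrite !mxE /= /horner_eval hornerD hornerM hornerX !hornerC.
have [q [c pq]] : exists q c, p = q * 'X + c%:P.
  by elim/poly_ind: p {pE} => [|q c _]; [exists 0, 0; rewrite mul0r add0r | exists q, c].
exists q.[x]; rewrite -pE; have := pE 0; rewrite scale0r addr0 => <-.
by rewrite pq !hornerE mulrC addrC.
Qed.

(** * The maps K |-> sum_i T_i K Z_i and their coranks *)

Section BlowUp.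
Variable R : comNzRingType.

Definition sandwich n k m a b (T : 'I_n -> 'M[R]_(b, a)) (Z : 'I_n -> 'M[R]_(k, m))
  (K : 'M[R]_(a, k)) : 'M[R]_(b, m) := \sum_i T i *m K *m Z i.

(** The matrix of [sandwich] acting on row vectors [mxvec K]. *)
Definition sandwich_mx n k m a b (T : 'I_n -> 'M[R]_(b, a)) (Z : 'I_n -> 'M[R]_(k, m)) :
  'M[R]_(a * k, b * m) := \sum_i lin_mulmx (T i) *m lin_mulmxr (Z i).

Lemma mul_sandwich_mx n k m a b (T : 'I_n -> 'M[R]_(b, a)) (Z : 'I_n -> 'M[R]_(k, m)) K :
  mxvec K *m sandwich_mx T Z = mxvec (sandwich T Z K).
Proof.
rewrite mulmx_sumr linear_sum; apply: eq_bigr => i _.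
by rewrite mulmxA !mul_vec_lin.
Qed.

Lemma sandwich_mx_linel n k m a b (T T' : 'I_n -> 'M[R]_(b, a)) (Z : 'I_n -> 'M[R]_(k, m)) s :
  sandwich_mx (fun i => T i + s *: T' i) Z = sandwich_mx T Z + s *: sandwich_mx T' Z.
Proof.
rewrite scaler_sumr -big_split; apply: eq_bigr => i _ /=.
by rewrite linearD linearZ /= mulmxDl scalemxAl.
Qed.

Lemma sandwich_mx_liner n k m a b (T : 'I_n -> 'M[R]_(b, a)) (Z Z' : 'I_n -> 'M[R]_(k, m)) s :
  sandwich_mx T (fun i => Z i + s *: Z' i) = sandwich_mx T Z + s *: sandwich_mx T Z'.
Proof.
rewrite scaler_sumr -big_split; apply: eq_bigr => i _ /=.
by rewrite linearD linearZ /= mulmxDr scalemxAr.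
Qed.

Lemma eq_mxvec_mul m n p (A B : 'M[R]_(m * n, p)) :
  (forall K : 'M_(m, n), mxvec K *m A = mxvec K *m B) -> A = B.
Proof.
by move=> H; apply/row_matrixP => i; rewrite !rowE -[delta_mx 0 i]vec_mxK H.
Qed.

Lemma mxvec_dot m n (A B : 'M[R]_(m, n)) :
  mxvec A *m (mxvec B)^T = (\tr (A *m B^T))%:M.
Proof.
have -> : \tr (A *m B^T) = \sum_i \sum_j A i j * B i j.
  by apply: eq_bigr => x _; rewrite mxE; apply: eq_bigr => y _; rewrite mxE.
apply/matrixP => i j; rewrite !ord1 [RHS]mxE eqxx mulr1n mxE.
rewrite (reindex _ (curry_mxvec_bij _ _)) /= pair_bigA /=.
by apply: eq_bigr => -[x y] _ /=; rewrite [_^T _ _]mxE !mxvecE.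
Qed.

Lemma trmx_lin_mulmx m n p (A : 'M[R]_(m, n)) :
  (lin_mulmx A : 'M_(n * p, m * p))^T = lin_mulmx A^T.
Proof.
apply: eq_mxvec_mul => K; apply: trmx_inj; rewrite trmx_mul trmxK mul_vec_lin /=.
apply: eq_mxvec_mul => H; rewrite mulmxA mul_vec_lin /= !mxvec_dot.
by rewrite trmx_mul trmxK -mulmxA mxtrace_mulC mulmxA.
Qed.

(** The trace form is nondegenerate, tested on elementary matrices. *)
Lemma trace_delta_eq0 m n (A : 'M[R]_(m, n)) :
  (forall x y, \tr (delta_mx x y *m A) = 0) -> A = 0.
Proof.
move=> H; apply/matrixP => i j; rewrite mxE -(H j i).
rewrite /mxtrace (bigD1 j) //= big1 ?addr0 => [|l /negPf lj]; rewrite mxE.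
  rewrite (bigD1 i) //= big1 ?addr0 ?mxE ?eqxx ?mul1r // => l /negPf li.
  by rewrite mxE li andbF mul0r.
by rewrite big1 // => r _; rewrite mxE lj mul0r.
Qed.

End BlowUp.

Lemma map_sandwich_mx (R S : comNzRingType) (f : {rmorphism R -> S}) n k m a b
    (T : 'I_n -> 'M[R]_(b, a)) (Z : 'I_n -> 'M[R]_(k, m)) :
  map_mx f (sandwich_mx T Z) = sandwich_mx (fun i => map_mx f (T i)) (fun i => map_mx f (Z i)).
Proof.
rewrite /sandwich_mx map_mx_sum; apply: eq_bigr => i _; rewrite map_mxM.
by congr (_ *m _); apply: map_lin_mx => A; rewrite map_mxM.
Qed.

Section Corank.
Variable F : fieldType.

Definition corank n k m a b (T : 'I_n -> 'M[F]_(b, a)) (Z : 'I_n -> 'M[F]_(k, m)) :=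
  \rank (kermx (sandwich_mx T Z)).

Lemma corankE n k m a b (T : 'I_n -> 'M[F]_(b, a)) (Z : 'I_n -> 'M[F]_(k, m)) :
  (corank T Z + \rank (sandwich_mx T Z) = a * k)%N.
Proof. by rewrite /corank mxrank_ker subnK // rank_leq_row. Qed.

Lemma sub_ker_sandwich n k m a b (T : 'I_n -> 'M[F]_(b, a)) (Z : 'I_n -> 'M[F]_(k, m)) K :
  (mxvec K <= kermx (sandwich_mx T Z))%MS = (sandwich T Z K == 0).
Proof.
by rewrite (sameP sub_kermxP eqP) mul_sandwich_mx mxvec_eq0.
Qed.

(** Blow-ups of different sizes are combined along an upper triangular block
    matrix; the off-diagonal block X is what can raise the rank beyond the sum
    of the two ranks. *)
Definition block_upper n a0 b0 a b (T0 : 'I_n -> 'M[F]_(b0, a0)) (X : 'I_n -> 'M[F]_(b0, a))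
  (T : 'I_n -> 'M[F]_(b, a)) i := block_mx (T0 i) (X i) 0 (T i).

Lemma sandwich_block n k m a0 b0 a b (T0 : 'I_n -> 'M[F]_(b0, a0)) (X : 'I_n -> 'M[F]_(b0, a))
    (T : 'I_n -> 'M[F]_(b, a)) (Z : 'I_n -> 'M[F]_(k, m)) K0 K :
  sandwich (block_upper T0 X T) Z (col_mx K0 K) = col_mx (sandwich T0 Z K0 + sandwich X Z K) (sandwich T Z K).
Proof.
rewrite /sandwich -big_split /=.
elim/big_rec3: _ => [|i U V W _ ->]; first by rewrite col_mx0.
rewrite mul_block_col mul_col_mx add_col_mx mul0mx add0r mulmxDl.
by [].
Qed.

(** A pair (K0, K) lies in the kernel of the triangular blow-up only if T kills
    K and the X-image of K is in the image of T0, hence orthogonal to L; the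
    latter cuts the kernel of T by the rank of the form (K, G) |-> <X K Z, G>. *)
Lemma corank_block n k m a0 b0 a b rL (T0 : 'I_n -> 'M[F]_(b0, a0)) (X : 'I_n -> 'M[F]_(b0, a))
    (T : 'I_n -> 'M[F]_(b, a)) (Z : 'I_n -> 'M[F]_(k, m)) (L : 'M_(rL, b0 * m)) :
  sandwich_mx T0 Z *m L^T = 0 ->
  (corank (block_upper T0 X T) Z + \rank (kermx (sandwich_mx T Z) *m (sandwich_mx X Z *m L^T))
    <= corank T0 Z + corank T Z)%N.
Proof.
move=> TL.
have eT := mxrank_mul_ker (kermx (sandwich_mx T Z)) (sandwich_mx X Z *m L^T).
suff : (corank (block_upper T0 X T) Z <=
    \rank (kermx (sandwich_mx T Z) :&: kermx (sandwich_mx X Z *m L^T))%MS + corank T0 Z)%N.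
  by rewrite /corank; move: eT; lia.
apply: (@rank_le_split _ _ _ _ _ _ _ _ (lin_mulmx (row_mx 0 1%:M))
   (lin_mulmx (row_mx 1%:M 0))) => [u|u|u]; rewrite -[u]vec_mxK -[vec_mx u]vsubmxK;
  move: (usubmx _) (dsubmx _) => K0 K.
- rewrite sub_ker_sandwich sandwich_block mul_vec_lin /= mul_row_col mul0mx add0r mul1mx.
  rewrite col_mx_eq0 => /andP[/eqP E1 E2].
  rewrite sub_capmx sub_ker_sandwich E2 /=; apply/sub_kermxP; rewrite mulmxA mul_sandwich_mx.
  rewrite (_ : sandwich X Z K = - sandwich T0 Z K0); last by apply/eqP; rewrite -addr_eq0 addrC E1.
  by rewrite linearN /= mulNmx -mul_sandwich_mx -mulmxA TL mulmx0 oppr0.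
- rewrite sub_ker_sandwich sandwich_block !mul_vec_lin /= !mul_row_col !mul0mx add0r !mul1mx.
  move=> h /(congr1 vec_mx); rewrite mxvecK linear0 => K_0; move: h; rewrite K_0 addr0.
  rewrite col_mx_eq0 sub_ker_sandwich => /andP[/eqP <- _].
  by rewrite [sandwich X Z 0]big1 ?addr0 // => i _; rewrite mulmx0 mul0mx.
rewrite !mul_vec_lin /= !mul_row_col !mul0mx add0r !mul1mx addr0.
move=> /(congr1 vec_mx) + /(congr1 vec_mx); rewrite !mxvecK !linear0 => -> ->.
by rewrite col_mx0 linear0.
Qed.

(** Passing to M diagonal copies rescales all dimensions by M, including a
    space L orthogonal to the image, and preserves every linear condition on
    the rows of the elements of L. *)
Lemma blowup_copies n k m a b rL (T : 'I_n -> 'M[F]_(b, a)) (Z : 'I_n -> 'M[F]_(k, m))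
    (L : 'M_(rL, b * m)) M : sandwich_mx T Z *m L^T = 0 ->
  exists (TM : 'I_n -> 'M[F]_(M * b, M * a)) rM (LM : 'M_(rM, (M * b) * m)),
  [/\ forall k' (Z' : 'I_n -> 'M[F]_(k', m)), (corank TM Z' <= M * corank T Z')%N,
      (M * \rank L <= \rank LM)%N,
      sandwich_mx TM Z *m LM^T = 0 &
      forall s (C : 'M_(m, s)), L *m lin_mulmxr C = 0 -> LM *m lin_mulmxr C = 0].
Proof.
move=> TL; elim: M => [|M [TM [rM [LM [HT HL HTL HV]]]]].
  exists (fun=> 0), 0%N, 0; split=> //.
  - by move=> k' Z'; rewrite /corank (leq_trans (rank_leq_row _)).
  - by apply/matrixP => i j; case: j.
  - by move=> s C _; rewrite mul0mx.
pose p1 : 'M[F]_(b, b + M * b) := row_mx 1%:M 0.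
pose p2 : 'M[F]_(M * b, b + M * b) := row_mx 0 1%:M.
have p1p1 : p1 *m p1^T = 1%:M by rewrite tr_row_mx trmx0 trmx1 mul_row_col mulmx0 addr0 mul1mx.
have p2p2 : p2 *m p2^T = 1%:M by rewrite tr_row_mx trmx0 trmx1 mul_row_col mulmx0 add0r mul1mx.
have p1p2 : p1 *m p2^T = 0 by rewrite tr_row_mx trmx0 trmx1 mul_row_col mulmx0 mul0mx addr0.
have linC c d e f (A : 'M[F]_(c, d)) (B : 'M[F]_(d, e)) :
    lin_mulmx B *m lin_mulmx A = lin_mulmx (A *m B) :> 'M_(e * f, c * f).
  by apply: eq_mxvec_mul => K; rewrite mulmxA !mul_vec_lin /= mulmxA.
have lin1 c d : lin_mulmx 1%:M = 1%:M :> 'M[F]_(c * d).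
  by apply: eq_mxvec_mul => K; rewrite mul_vec_lin /= mulmx1 mul1mx.
have linR c d s t (A : 'M[F]_(c, d)) (C : 'M[F]_(s, t)) :
    lin_mulmx A *m lin_mulmxr C = lin_mulmxr C *m lin_mulmx A.
  by apply: eq_mxvec_mul => K; rewrite !mulmxA !mul_vec_lin /= mulmxA.
pose T' := block_upper T (fun=> 0) TM.
have e1 : sandwich_mx T' Z *m lin_mulmx p1 = lin_mulmx (row_mx 1%:M 0) *m sandwich_mx T Z.
  apply: eq_mxvec_mul => K; rewrite mulmxA mul_sandwich_mx -[K]vsubmxK sandwich_block mulmxA !mul_vec_lin /=.
  rewrite mul_sandwich_mx !mul_row_col !mul0mx !mul1mx !addr0 [X in _ + X]big1 ?addr0 // => i _.
  by rewrite !mul0mx.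
have e2 : sandwich_mx T' Z *m lin_mulmx p2 = lin_mulmx (row_mx 0 1%:M) *m sandwich_mx TM Z.
  apply: eq_mxvec_mul => K; rewrite mulmxA mul_sandwich_mx -[K]vsubmxK sandwich_block mulmxA !mul_vec_lin /=.
  by rewrite mul_sandwich_mx !mul_row_col !mul0mx !mul1mx !add0r.
exists T', (rL + rM)%N, (col_mx (L *m lin_mulmx p1^T) (LM *m lin_mulmx p2^T)); split.
- move=> k' Z'; apply: (@leq_trans (corank T Z' + M * corank T Z')%N) => //.
  apply: leq_trans (leq_add (leqnn _) (HT _ _)).
  have := @corank_block _ _ _ _ _ _ _ 0 T (fun=> 0) TM Z' 0.
  by rewrite trmx0 !mulmx0 mxrank0 addn0; apply.
- have z : LM *m lin_mulmx p2^T *m lin_mulmx p1 = 0.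
    rewrite -mulmxA linC p1p2; apply/row_matrixP => i; rewrite row_mul.
    by rewrite linear0 mulmx0 row0.
  have := rank_col_ge (L *m lin_mulmx p1^T) z.
  rewrite -mulmxA linC p1p1 lin1 mulmx1 => h; apply: leq_trans h.
  apply: (@leq_trans (\rank L + M * \rank L)%N) => //.
  rewrite leq_add2l (leq_trans HL) //.
  rewrite -{1}[LM]mulmx1 -lin1 -p2p2 -linC mulmxA mxrankM_maxl //.
- rewrite tr_col_mx mul_mx_row !trmx_mul !trmx_lin_mulmx !trmxK !mulmxA e1 e2.
  by rewrite -!mulmxA TL HTL !mulmx0 row_mx0.
- move=> s C LC; rewrite mul_col_mx -!mulmxA !linR !mulmxA LC HV //.
  by rewrite !mul0mx col_mx0.
Qed.

End Corank.

(** * Noncommutative rank: expansion is certified by blow-ups *)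

Lemma exists_maximal (T : Type) (x0 : T) (f : T -> nat) B :
  (forall x, f x <= B)%N -> exists x, forall y, (f y <= f x)%N.
Proof.
move=> fB; pose P d := `[< exists x, f x = d >].
have exP : exists d, P d by exists (f x0); apply/asboolP; exists x0.
have ubP d : P d -> (d <= B)%N by move=> /asboolP[x <-].
case: (ex_maxnP exP ubP) => d /asboolP[x <-] H.
by exists x => y; apply: H; apply/asboolP; exists y.
Qed.

Section NoncommutativeRank.
Variable F : fieldType.
Hypothesis Finf : has_nonroots F.

(** Subspaces are row spaces here, so that the Z_i act on the right: for a
    tuple Y acting on columns, Z_i is the transpose of Y_i. *)
Definition image_space n r k m (B : 'M[F]_(r, k)) (Z : 'I_n -> 'M[F]_(k, m)) : 'M[F]_m :=
  (\sum_i <<B *m Z i>>)%MS.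

Definition expanding p q n k m (Z : 'I_n -> 'M[F]_(k, m)) :=
  forall r (B : 'M_(r, k)), (q * \rank B <= p * \rank (image_space B Z))%N.

Lemma expanding_restrict p q n k m r (Z : 'I_n -> 'M[F]_(k, m)) (B : 'M_(r, k)) :
  row_free B -> expanding p q Z -> expanding p q (fun i => B *m Z i).
Proof.
move=> fB eZ s C; have := eZ s (C *m B); rewrite mxrankMfree //.
by rewrite /image_space; under eq_bigr do rewrite -mulmxA.
Qed.

Variables (p q n : nat).

Section Step.
Variables (k m e e' j : nat) (Z : 'I_n -> 'M[F]_(k, m)).
Hypothesis e_gt0 : (0 < e)%N.
Hypothesis e'E : (e * (6 + 2 * k) <= e')%N.
Hypothesis lt_e'j : (e' < e * j)%N.
Hypothesis corank_lower : forall N a b (T : 'I_n -> 'M[F]_(b, a)),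
  (0 < N)%N -> a = (q * N)%N -> b = (p * N)%N -> (j * N < e' * corank T Z + N)%N.

(** A stage in building a violation of expansion, once the coranks of all
    blow-ups of size N are known to be about j N / e'.  L consists of matrices
    orthogonal to the image of one blow-up, and still has dimension about
    j N / e'; V is a space of dimension at least r whose images under the Z_i
    are orthogonal to the rows of all elements of L.  When V is everything, L
    must vanish, which bounds j. *)
Definition orthogonal_pair r := exists N a b (T : 'I_n -> 'M[F]_(b, a)) rL (L : 'M[F]_(rL, b * m))
    (V : 'M[F]_k),
  [/\ (0 < N)%N, a = (q * N)%N & b = (p * N)%N] /\
  [/\ (e' * corank T Z <= j * N)%N, (r <= \rank V)%N,
      (j * N <= e' * \rank L + (1 + 2 * r) * N)%N,
      sandwich_mx T Z *m L^T = 0 &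
      forall i, L *m lin_mulmxr ((V *m Z i)^T) = 0].

(** Take X maximizing the rank of the form (K, G) |-> <X K Z, G> on the kernel
    of T and L.  By [max_rank_first_order] the left and right kernels K, G of
    that form are also orthogonal for every other X', and letting X' run over
    the elementary matrices in one slot gives K Z_i G^T = 0. *)
Lemma form_first_order a b b0 rL (T : 'I_n -> 'M[F]_(b, a)) (L : 'M[F]_(rL, b0 * m)) :
  exists (X : 'I_n -> 'M[F]_(b0, a)),
    forall (K : 'M_(a, k)) (G : 'M_(b0, m)),
    (mxvec K <= kermx (sandwich_mx T Z) :&: kermx (sandwich_mx X Z *m L^T))%MS ->
    (mxvec G <= L :&: kermx ((kermx (sandwich_mx T Z) *m sandwich_mx X Z)^T))%MS ->
    forall i, K *m Z i *m G^T = 0.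
Proof.
move: (kermx (sandwich_mx T Z)) => KK.
pose bX (X : 'I_n -> 'M[F]_(b0, a)) := KK *m sandwich_mx X Z *m L^T.
have [X maxX] : exists X, forall X', (\rank (bX X') <= \rank (bX X))%N.
  by apply: (exists_maximal (fun=> 0)) => X; exact: rank_leq_col.
exists X => K G; rewrite !sub_capmx => /andP[/submxP[u Ku] /sub_kermxP KX].
move=> /andP[/submxP[v Gv] /sub_kermxP GX] i; apply: trace_delta_eq0 => x y.
pose X' l : 'M[F]_(b0, a) := if l == i then delta_mx x y else 0.
have ubX : u *m bX X = 0 by rewrite /bX !mulmxA -Ku -mulmxA.
have bXv : bX X *m v^T = 0.
  by rewrite /bX -mulmxA -trmx_mul -Gv -[_ *m (mxvec G)^T]trmxK trmx_mul trmxK GX trmx0.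
have maxb s : (\rank (bX X + s *: bX X')%R <= \rank (bX X))%N.
  rewrite (_ : bX X + s *: bX X' = bX (fun i => X i + s *: X' i)) //.
  by rewrite /bX sandwich_mx_linel mulmxDr mulmxDl -scalemxAr -scalemxAl.
have := max_rank_first_order Finf maxb ubX bXv.
rewrite /bX !mulmxA -Ku -mulmxA -trmx_mul -Gv mul_sandwich_mx mxvec_dot.
rewrite /sandwich (bigD1 i) //= big1 ?addr0 => [|l /negPf li]; last by rewrite /X' li !mul0mx.
rewrite /X' eqxx -!mulmxA => /matrixP /(_ 0 0).
by rewrite !mxE eqxx mulr1n.
Qed.

(** To enlarge V, choose a blow-up T whose corank is nearly minimal both on the
    whole space and on V, the latter being small by induction on the dimension.
    Minimality of coranks applied to [block_upper T0' X T] bounds the rank of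
    the form of [form_first_order] by 2 N / e', so its left kernel is still too
    big to consist of matrices with rows in V, and its right kernel is a large
    part of L.  Any row space of the left kernel may be added to V. *)
Lemma orthogonal_pair_step r :
  (forall (B : 'M[F]_(r, k)), row_free B ->
     exists N (T : 'I_n -> 'M[F]_(p * N, q * N)), (0 < N)%N /\
        (2 * e * corank T (fun i => B *m Z i) <= N)%N) ->
  orthogonal_pair r -> orthogonal_pair r.+1.
Proof.
move=> IH [N [a [b [T0 [rL [L [V [[N0 aE bE] [cT0 rV jL TL VL]]]]]]]]].
have [ltrV|] := ltnP r (\rank V).
  exists N, a, b, T0, rL, L, V; split; split => //.
  by apply: leq_trans jL _; rewrite leq_add2l leq_mul2r; lia.
move=> leVr; have Vr : \rank V = r by apply/eqP; rewrite eqn_leq leVr.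
(* B is a basis of V, so B *m Z i is the restriction of Z i to V. *)
have [B [fB VB]] : exists B : 'M[F]_(r, k), row_free B /\ (V <= B)%MS.
  by rewrite -Vr; exists (row_base V); rewrite row_base_free eq_row_base.
have [N1 [T1 [N1_0 cT1]]] := IH B fB.
(* The two blow-ups are brought to the common size N1 * N before joining them. *)
have [T0' [rM [L' [cT0' rL' TL' VL']]]] := blowup_copies N1 TL.
have [T1' cT1'] : exists T1' : 'I_n -> 'M[F]_(N1 * b, N1 * a),
    (2 * e * corank T1' (fun i => B *m Z i) <= N1 * N)%N.
  have [|T1' [_ [_ [H _ _ _]]]] := @blowup_copies _ _ _ _ _ _ 0 T1 Z 0 N.
    by rewrite trmx0 mulmx0.
  have : exists T : 'I_n -> 'M[F]_(N * (p * N1), N * (q * N1)),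
    (2 * e * corank T (fun i => B *m Z i) <= N1 * N)%N.
    exists T1'; apply: leq_trans (leq_mul (leqnn _) (H _ _)) _.
    by rewrite mulnCA mulnC leq_mul2r cT1 orbT.
  by rewrite aE bE ![(N1 * (_ * N))%N]mulnC ![(_ * N * N1)%N]mulnAC ![(_ * N1 * N)%N]mulnC.
have [s [rT rTB]] := rank_line_join (sandwich_mx T0' Z) (sandwich_mx T1' Z)
  (sandwich_mx T0' (fun i => B *m Z i)) (sandwich_mx T1' (fun i => B *m Z i)) Finf.
pose T i := T0' i + s *: (T1' i - T0' i).
have TE k' (Z' : 'I_n -> 'M_(k', m)) :
    sandwich_mx T0' Z' + s *: (sandwich_mx T1' Z' - sandwich_mx T0' Z') = sandwich_mx T Z'.
  rewrite /T sandwich_mx_linel; congr (_ + s *: _).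
  rewrite -scaleN1r -sandwich_mx_linel; apply: congr2 => //; apply: funext => i.
  by rewrite scaleN1r.
rewrite !TE in rT rTB.
have cT : (corank T Z <= N1 * corank T0 Z)%N.
  apply: leq_trans (cT0' _ Z).
  by have := corankE T Z; have := corankE T0' Z; move: rT; lia.
have cTB : (2 * e * corank T (fun i => B *m Z i) <= N1 * N)%N.
  apply: leq_trans cT1'; rewrite leq_mul2l; apply/orP; right.
  by have := corankE T (fun i => B *m Z i); have := corankE T1' (fun i => B *m Z i);
    move: rTB; lia.
have [X HX] := form_first_order T L'.
set rk := \rank (kermx (sandwich_mx T Z) *m (sandwich_mx X Z *m L'^T)).
(* The form has small rank, as the coranks of T0' and T nearly attain the infimum. *)
have rk_lt : (e' * rk < 2 * (N1 * N))%N.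
  have := corank_block X T TL'; rewrite -/rk => h1.
  have h2 := @corank_lower (N1 * N + N1 * N)%N _ _ (block_upper T0' X T).
  have {h2} : (j * (N1 * N + N1 * N) <
     e' * corank (block_upper T0' X T) Z + (N1 * N + N1 * N))%N.
    by apply: h2; rewrite ?aE ?bE; nia.
  have := leq_mul (leqnn e') h1; have := cT0' _ Z.
  have : (e' * (N1 * corank T0 Z) <= N1 * (j * N))%N.
    by rewrite mulnCA leq_mul2l cT0 orbT.
  move: cT; move: (corank _ _) (corank _ _) (corank _ _) (corank _ _) => c1 c2 c3 c4.
  move=> h3 h4 h5 h6 h7.
  have := leq_mul (leqnn e') h3; have := leq_mul (leqnn e') h5.
  by move: h4 h6 h7; rewrite !mulnDr; move: (e' * _)%N (e' * _)%N; nia.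
set K0 := (kermx (sandwich_mx T Z) :&: kermx (sandwich_mx X Z *m L'^T))%MS.
have rK0 : (rk + \rank K0 = corank T Z)%N by apply: mxrank_mul_ker.
have ltK0 : (j * (N1 * N) < e' * \rank K0 + 3 * (N1 * N))%N.
  have : (j * (N1 * N) < e' * corank T Z + N1 * N)%N.
    by apply: corank_lower; rewrite ?muln_gt0 ?N0 ?N1_0 // ?aE ?bE mulnCA.
  by rewrite -rK0 mulnDr; lia.
(* Otherwise K0 would embed in the kernel of the restriction of T to V. *)
have [i KV] : exists i, ~~ (vec_mx (row i K0) <= V)%MS.
  apply/existsP; rewrite -negb_forall; apply/negP => /forallP KV.
  have KB (u : 'rV_(N1 * a * k)) : (u <= K0)%MS -> (vec_mx u <= B)%MS.
    move=> /submxP[w ->]; rewrite mulmx_sum_row linear_sum summx_sub // => l _.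
    by rewrite linearZ scalemx_sub // (submx_trans (KV l)).
  have rKB : (\rank K0 <= corank T (fun i => B *m Z i))%N.
    have E : K0 *m lin_mulmxr (pinvmx B) *m lin_mulmxr B = K0.
      apply/row_matrixP => l; rewrite !row_mul -[row l K0]vec_mxK !mul_vec_lin /=.
      by rewrite mulmxKpV // KB // row_sub.
    rewrite -E (leq_trans (mxrankM_maxl _ _)) //; apply: mxrankS.
    apply/row_subP => l; rewrite row_mul -[row l K0]vec_mxK mul_vec_lin sub_ker_sandwich /=.
    have KBl : (vec_mx (row l K0) <= B)%MS by rewrite KB // row_sub.
    rewrite /sandwich; under eq_bigr do rewrite mulmxA -[_ *m (_ *m _) *m _]mulmxA mulmxKpV //.
    by rewrite -/(sandwich _ _ _) -sub_ker_sandwich vec_mxK (submx_trans (row_sub _ _)) ?capmxSl.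
  have := leq_trans (leq_mul (leqnn (2 * e)) rKB) cTB.
  move: ltK0 lt_e'j e'E e_gt0 (N0) (N1_0); clear; move: (\rank K0) => x.
  have : (0 < N -> 0 < N1 -> 0 < N1 * N)%N by rewrite muln_gt0 => -> ->.
  move: (N1 * N)%N => M H lt1 lt2 le3 e0 N0 N10 le4; have {H N0 N10} M0 := H N0 N10.
  have : (2 * e * (j * M) < e' * M + 6 * e * M)%N.
    have : (e' * (2 * e * x) <= e' * M)%N by rewrite leq_mul2l le4 orbT.
    have : (2 * e * (j * M) < 2 * e * (e' * x + 3 * M))%N by rewrite ltn_pmul2l //; lia.
    by nia.
  have : (e' * M < e * j * M)%N by rewrite ltn_pmul2r.
  have : (e * 6 * M <= e' * M)%N by rewrite leq_pmul2r //; nia.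
  by nia.
set L1 := (L' :&: kermx ((kermx (sandwich_mx T Z) *m sandwich_mx X Z)^T))%MS.
have rL1 : (rk + \rank L1 = \rank L')%N.
  rewrite -(mxrank_mul_ker L' ((kermx (sandwich_mx T Z) *m sandwich_mx X Z)^T)); congr (_ + _)%N.
  by rewrite -[in RHS]mxrank_tr trmx_mul trmxK -mulmxA.
exists (N1 * N)%N, (N1 * a)%N, (N1 * b)%N, T0', (N1 * b * m)%N, L1,
  (V + vec_mx (row i K0))%MS.
split; first by rewrite muln_gt0 N0 N1_0 aE bE ![(N1 * (_ * N))%N]mulnCA.
have LL' : (L1 <= L')%MS by exact: capmxSl.
split.
- have := leq_mul (leqnn e') (cT0' _ Z); have := leq_mul (leqnn N1) cT0.
  by rewrite ![(N1 * (_ * _))%N]mulnCA => h1 h2; apply: leq_trans h2 h1.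
- rewrite -Vr; apply: rank_ltmx.
  by rewrite ltmxE addsmxSl addsmx_sub submx_refl.
- have := leq_mul (leqnn N1) jL; have := leq_mul (leqnn e') rL'.
  rewrite -rL1; move: rk_lt; move: (\rank L) (\rank L1) => x y; clear; move: rk => z.
  by nia.
- by have /submxP[D ->] := LL'; rewrite trmx_mul mulmxA TL' mul0mx.
- move=> l; apply/row_matrixP => h; rewrite row_mul row0 -[row h L1]vec_mxK mul_vec_lin /=.
  set G := vec_mx (row h L1).
  have GL1 : (mxvec G <= L1)%MS by rewrite vec_mxK row_sub.
  suff : ((V + vec_mx (row i K0))%MS <= kermx (Z l *m G^T))%MS.
    move/sub_kermxP; rewrite mulmxA => /(congr1 trmx); rewrite trmx_mul trmxK trmx0 => ->.
    by rewrite linear0.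
  rewrite addsmx_sub; apply/andP; split; apply/sub_kermxP; rewrite mulmxA.
    have /submxP[D GD] := submx_trans GL1 LL'.
    have : mxvec G *m lin_mulmxr ((V *m Z l)^T) = 0 by rewrite GD -mulmxA VL' ?mulmx0.
    rewrite mul_vec_lin /= => /(congr1 vec_mx); rewrite mxvecK linear0 => /(congr1 trmx).
    by rewrite trmx_mul trmxK trmx0.
  by apply: HX; rewrite ?vec_mxK ?row_sub.
Qed.

End Step.

(** Let j / e' approximate from above the infimum of corank / N up to 1 / e'.
    If j is large, all steps of [orthogonal_pair_step] can be carried out; the
    final V is the whole space, so L is orthogonal to the full image and
    vanishes although its dimension is positive. *)
Lemma corank_small_full k m e (Z : 'I_n -> 'M[F]_(k, m)) :
  (0 < e)%N -> row_full (image_space 1%:M Z) -> expanding p q Z ->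
  (forall k' (Z' : 'I_n -> 'M[F]_(k', m)) e1, (k' < k)%N -> expanding p q Z' -> (0 < e1)%N ->
    exists N (T : 'I_n -> 'M[F]_(p * N, q * N)), (0 < N)%N /\ (e1 * corank T Z' <= N)%N) ->
  exists N (T : 'I_n -> 'M[F]_(p * N, q * N)), (0 < N)%N /\ (e * corank T Z <= N)%N.
Proof.
move=> e0 fullZ eZ IH; pose e' := (e * (6 + 2 * k))%N.
pose P j := `[< exists N (T : 'I_n -> 'M[F]_(p * N, q * N)),
  (0 < N)%N /\ (e' * corank T Z <= j * N)%N >].
have exP : exists j, P j.
  exists (e' * (q * 1 * k))%N; apply/asboolP; exists 1%N, (fun=> 0); split=> //.
  by rewrite [leqRHS]muln1 leq_mul2l rank_leq_row orbT.
case: (ex_minnP exP) => j /asboolP[N [T [N0 cT]]] minP.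
have corank_lower N' a b (T' : 'I_n -> 'M[F]_(b, a)) : (0 < N')%N -> a = (q * N')%N -> b = (p * N')%N ->
    (j * N' < e' * corank T' Z + N')%N.
  move=> N'0 aE bE; subst a b; rewrite ltnNge; apply/negP => h.
  case: j cT minP h => [|j] cT minP h.
    by move: h; rewrite mul0n leqn0 addn_eq0 => /andP[_ /eqP N'E]; rewrite N'E in N'0.
  suff /minP : P j by rewrite ltnn.
  by apply/asboolP; exists N', T'; split=> //; move: h; rewrite mulSn addnC leq_add2l.
(* If j / e' <= 1 / e there is nothing left to prove. *)
have [le_ej|lt_ej] := leqP (e * j) e'.
  exists N, T; split=> //.
  rewrite -(@leq_pmul2l e') ?muln_gt0 ?e0 // mulnCA.
  apply: leq_trans (leq_mul (leqnn e) cT) _.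
  by rewrite mulnA leq_mul2r le_ej orbT.
have pair0 : orthogonal_pair e' j Z 0.
  exists N, (q * N)%N, (p * N)%N, T, (p * N * m)%N, (kermx (sandwich_mx T Z)^T), 0; split => //; split=> //.
  - have h := corank_lower _ _ _ T N0 erefl erefl.
    rewrite (leq_trans (ltnW h)) // muln0 addn0 mul1n leq_add2r leq_mul2l; apply/orP; right.
    rewrite mxrank_ker mxrank_tr; have := corankE T Z.
    have : (q * k <= p * m)%N.
      have := eZ _ 1%:M; rewrite mxrank1 => h1; apply: leq_trans h1 _.
      by rewrite leq_mul2l rank_leq_col orbT.
    have := rank_leq_col (sandwich_mx T Z).
    move: (\rank (sandwich_mx T Z)) (corank T Z) => x y.
    rewrite ![(_ * N * _)%N]mulnAC.
    move=> h1 h2 h3; have := leq_mul h2 (leqnn N); lia.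
  - by apply: trmx_inj; rewrite trmx_mul trmxK mulmx_ker trmx0.
  - by move=> i; rewrite mul0mx trmx0 linear0 mulmx0.
have pairs r : (r <= k)%N -> orthogonal_pair e' j Z r.
  elim: r => // r IHr ltrk; apply: (@orthogonal_pair_step k m e e' j Z) => //; last exact/IHr/ltnW.
  move=> B fB; apply: IH => //; first exact: expanding_restrict.
  by rewrite muln_gt0 e0.
have [N' [a [b [T' [rL [L [V [[N'0 aE bE] [cT' rV jL TL VL]]]]]]]]] := pairs k (leqnn k).
suff L0 : L = 0.
  have h : (j <= 1 + 2 * k)%N by rewrite -(@leq_pmul2r N') //; rewrite L0 mxrank0 muln0 in jL.
  move: lt_ej; rewrite /e' ltn_pmul2l // => h1; lia.
have fV : row_full V by rewrite /row_full eqn_leq rank_leq_col.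
apply/row_matrixP => h; rewrite row0 -[row h L]vec_mxK; set G := vec_mx _.
suff -> : G = 0 by rewrite linear0.
suff : (image_space 1%:M Z <= kermx G^T)%MS.
  move=> /(submx_trans (submx_full 1%:M fullZ)) /sub_kermxP; rewrite mul1mx => GT.
  by rewrite -[G]trmxK GT trmx0.
apply/sumsmx_subP => i _; rewrite genmxE mul1mx; apply/sub_kermxP.
have := VL i => /(congr1 (row h)); rewrite row_mul -[row h L]vec_mxK -/G mul_vec_lin row0 /=.
move=> /(congr1 vec_mx); rewrite mxvecK linear0 => /(congr1 trmx).
rewrite trmx_mul trmxK trmx0 -mulmxA => h'.
by rewrite -[Z i *m _]mul1mx -(mulVpmx fV) -(mulmxA (pinvmx V)) h' mulmx0.
Qed.

(** The reduction to [corank_small_full] replaces the target space by the span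
    W of the images. *)
Theorem expanding_corank_small k m (Z : 'I_n -> 'M[F]_(k, m)) e :
  expanding p q Z -> (0 < e)%N ->
  exists N (T : 'I_n -> 'M[F]_(p * N, q * N)), (0 < N)%N /\ (e * corank T Z <= N)%N.
Proof.
elim/ltn_ind: k m Z e => k IH m Z e eZ e0.
pose W := image_space 1%:M Z.
pose Z' i := Z i *m pinvmx (row_base W).
have ZE i : Z i = Z' i *m row_base W.
  rewrite /Z' mulmxKpV // eq_row_base.
  by apply: (@sumsmx_sup _ _ i) => //; rewrite genmxE mul1mx.
have rZ' r (B : 'M_(r, k)) : \rank (image_space B Z') = \rank (image_space B Z).
  rewrite -(mxrankMfree _ (row_base_free W)).
  suff E : (image_space B Z' *m row_base W :=: image_space B Z)%MS by rewrite E.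
  rewrite /image_space; apply: eqmx_trans (sumsmxMr_gen _ _ _) _.
  apply: eqmx_sums => i _; apply/eqmxP; rewrite !genmxE.
  by rewrite !(eqmxMr _ (genmxE _)) -mulmxA -ZE submx_refl.
have [|||N [T [N0 cT]]] := @corank_small_full k _ e Z' e0.
- by rewrite /row_full rZ'.
- by move=> r B; rewrite rZ'; exact: eZ.
- by move=> k' Z1 e1 ltk eZ1 e10; apply: IH.
exists N, T; split=> //; apply: leq_trans cT; rewrite leq_mul2l; apply/orP; right.
apply: mxrankS; apply/row_subP => i; rewrite -[row i _]vec_mxK sub_ker_sandwich.
have : (mxvec (vec_mx (row i (kermx (sandwich_mx T Z)))) <= kermx (sandwich_mx T Z))%MS.
  by rewrite vec_mxK row_sub.
rewrite sub_ker_sandwich; set K := vec_mx _.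
have -> : sandwich T Z K = sandwich T Z' K *m row_base W.
  by rewrite /sandwich mulmx_suml; apply: eq_bigr => l _; rewrite {1}ZE mulmxA.
by move=> /eqP h; apply/eqP/(row_free_inj (row_base_free W)); rewrite h mul0mx.
Qed.

End NoncommutativeRank.

(** The matrices with rows in the row space of B, a space of dimension
    a * rank B, are mapped to matrices with rows in the image space. *)
Lemma corank_ge (F : fieldType) n k m a b r (T : 'I_n -> 'M[F]_(b, a)) (Z : 'I_n -> 'M[F]_(k, m))
    (B : 'M_(r, k)) :
  (a * \rank B <= b * \rank (image_space B Z) + corank T Z)%N.
Proof.
set W := image_space B Z; pose U := lin_mulmxr (row_base B) : 'M_(a * \rank B, a * k).
have fU : row_free U.
  apply/row_freeP; exists (lin_mulmxr (pinvmx (row_base B))); apply: eq_mxvec_mul => K.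
  by rewrite mulmxA !mul_vec_lin /= -mulmxA mulmxVp ?row_base_free // !mulmx1.
have <- : \rank U = (a * \rank B)%N by apply/eqP.
rewrite -(mxrank_mul_ker U (sandwich_mx T Z)) leq_add // ?mxrankS ?capmxSr //.
apply: leq_trans (rank_leq_row (lin_mulmxr (row_base W) : 'M_(b * \rank W, b * m))).
apply: mxrankS; apply/row_subP => i; rewrite row_mul -[row i U]vec_mxK mul_sandwich_mx.
have : (vec_mx (row i U) <= row_base B)%MS.
  by rewrite /U rowE -[delta_mx _ _]vec_mxK mul_vec_lin mxvecK submxMl.
move=> /submxP[D ->]; set G := sandwich _ _ _.
have /submxP[H ->] : (G <= row_base W)%MS.
  rewrite eq_row_base; apply: summx_sub => l _.
  apply: (@sumsmx_sup _ _ l) => //; rewrite genmxE.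
  rewrite (mulmxA (T l) D) -(mulmxA _ (row_base B)).
  by apply: submx_trans (submxMl _ _) _; apply: submxMr; rewrite eq_row_base.
by have := mul_vec_lin (mulmxr (row_base W)) H => /= <-; exact: submxMl.
Qed.

(** * Tangent surjectivity makes every tuple non-expanding *)

Section HenselLift.
Variables (F : fieldType) (n l c k a : nat).
Variables (P : 'I_n -> 'M[F]_(l, k)) (X : 'I_n -> 'M[F]_(c, a)).

(** The differential of the family of tuples with vanishing lower left block
    after row and column operations by u and w, taken at the block diagonal
    tuple with blocks P i and X i, is onto in the lower left directions. *)
Definition tangent_onto := forall E : 'I_n -> 'M[F]_(c, k),
  exists (u : 'M_(c, l)) (w : 'M_(a, k)), forall i, u *m P i + X i *m w = E i.

Hypothesis PX : tangent_onto.

(** Solving for elementary right-hand sides over F solves the system over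
    {poly F} by linearity. *)
Lemma tangent_onto_poly (E : 'I_n -> 'M[{poly F}]_(c, k)) :
  exists (u : 'M_(c, l)) (w : 'M_(a, k)),
    forall i, u *m map_mx polyC (P i) + map_mx polyC (X i) *m w = E i.
Proof.
pose d (e : 'I_n * 'I_c * 'I_k) (i : 'I_n) : 'M[F]_(c, k) :=
  if i == e.1.1 then delta_mx e.1.2 e.2 else 0.
have /boolp.choice[f Hf] e : exists uw : 'M[F]_(c, l) * 'M[F]_(a, k),
    forall i, uw.1 *m P i + X i *m uw.2 = d e i.
  by have [u [w H]] := PX (d e); exists (u, w).
exists (\sum_e E e.1.1 e.1.2 e.2 *: map_mx polyC (f e).1),
       (\sum_e E e.1.1 e.1.2 e.2 *: map_mx polyC (f e).2) => i.
rewrite mulmx_suml mulmx_sumr -big_split /=.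
transitivity (\sum_e E e.1.1 e.1.2 e.2 *: map_mx polyC (d e i)).
  apply: eq_bigr => e _; rewrite -Hf map_mxD !map_mxM scalerDr.
  by rewrite scalemxAl scalemxAr.
rewrite -(pair_bigA _ (fun e y => E e.1 e.2 y *: map_mx polyC (d (e, y) i))) /=.
rewrite -(pair_bigA _ (fun i0 x => \sum_y E i0 x y *: map_mx polyC (d (i0, x, y) i))) /=.
rewrite (bigD1 i) //= [X in _ + X]big1 ?addr0 => [|j /negPf ji]; last first.
  by apply: big1 => x _; apply: big1 => y _; rewrite /d /= eq_sym ji map_mx0 scaler0.
rewrite [RHS]matrix_sum_delta; apply: eq_bigr => x _; apply: eq_bigr => y _.
by rewrite /d /= eqxx map_delta_mx.
Qed.

(** Newton iteration along the line from the block diagonal tuple Y1 to Y, with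
    the indeterminate t of {poly F} as parameter: the residual t^M E is removed
    by a correction of u and w of order t^M, and what this correction leaves
    behind is of order t^(M+1), because the tuple differs from Y1 by a multiple
    of t. *)
Lemma hensel_lift (Y : 'I_n -> 'M[F]_(l + c, k + a)) M :
  exists (u : 'M[{poly F}]_(c, l)) (w : 'M_(a, k)) (E : 'I_n -> 'M_(c, k)),
  forall i, let Y1 := block_mx (P i) 0 0 (X i) in
  row_mx u 1%:M *m (map_mx polyC Y1 + 'X *: map_mx polyC (Y i - Y1)) *m col_mx 1%:M w
  = 'X^M *: E i.
Proof.
elim: M => [|M [u [w [E HE]]]].
  by eexists 0, 0, _ => i /=; rewrite expr0 scale1r.
have [u' [w' H]] := tangent_onto_poly (fun i => - E i).
pose P' i := map_mx polyC (ulsubmx (Y i) - P i).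
pose D' i := map_mx polyC (drsubmx (Y i) - X i).
pose B' i := map_mx polyC (ursubmx (Y i)).
pose C' i := map_mx polyC (dlsubmx (Y i)).
have YE i : let Y1 := block_mx (P i) 0 0 (X i) in
    map_mx polyC Y1 + 'X *: map_mx polyC (Y i - Y1) =
    block_mx (map_mx polyC (P i) + 'X *: P' i) ('X *: B' i)
             ('X *: C' i) (map_mx polyC (X i) + 'X *: D' i).
  move=> /=; rewrite -[Y i in LHS]submxK opp_block_mx add_block_mx !map_block_mx.
  rewrite scale_block_mx add_block_mx !oppr0 !addr0 !map_mx0 !add0r.
  by [].
have mulE (v : 'M_(c, l)) (z : 'M_(a, k)) i : let Y1 := block_mx (P i) 0 0 (X i) in
    row_mx v 1%:M *m (map_mx polyC Y1 + 'X *: map_mx polyC (Y i - Y1)) *m col_mx 1%:M z =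
    'X *: C' i + (v *m map_mx polyC (P i) + map_mx polyC (X i) *m z) +
    'X *: (v *m P' i) + 'X *: (D' i *m z) + 'X *: (v *m B' i *m z).
  rewrite /= YE mul_row_block mul_row_col !mul1mx mulmx1 !mulmxDr !mulmxDl -!scalemxAr -!scalemxAl.
  move: (v *m _) (v *m _) ('X *: C' i) (_ *m z) (_ *m z) (_ *m z) => *.
  by apply/matrixP => x y; rewrite !mxE; ring.
exists (u + 'X^M *: u'), (w + 'X^M *: w'),
  (fun i => u' *m P' i + D' i *m w' + u' *m B' i *m w + u *m B' i *m w' +
     'X^M *: (u' *m B' i *m w')) => i /=.
have := HE i; have := H i; rewrite /= !mulE.
rewrite !mulmxDl !mulmxDr -?scalemxAl -?scalemxAr -?scalemxAl.
move: (u *m map_mx polyC (P i)) (u' *m map_mx polyC (P i)) (map_mx polyC (X i) *m w)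
  (map_mx polyC (X i) *m w') (u *m P' i) (u' *m P' i) (D' i *m w) (D' i *m w')
  (u *m B' i *m w) (u' *m B' i *m w) (u *m B' i *m w') (u' *m B' i *m w') (C' i) (E i).
move=> m1 m2 m3 m4 m5 m6 m7 m8 m9 m10 m11 m12 m13 m14 h1 h2.
apply/matrixP => x y; move/matrixP/(_ x y): h1; move/matrixP/(_ x y): h2.
rewrite !mxE exprS => h2 h1.
have hE : m14 x y = - (m2 x y + m4 x y) by rewrite h1 opprK.
(* The old residual identity, solved for one of its terms. *)
have h3 : m1 x y = 'X^M * m14 x y - 'X * m13 x y - m3 x y - 'X * m5 x y - 'X * m7 x y
   - 'X * m9 x y by rewrite -h2; ring.
by rewrite h3 hE; ring.
Qed.

End HenselLift.

(** Modulo t^M the tuple Yt on the line agrees with Y', which at every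
    parameter s is not expanding since its lower left block can be cleared.
    Hence the minors of size exceeding the ranks allowed by [corank_ge] vanish
    for Y' and are divisible by t^M for Yt, whereas a certificate for Y is such
    a minor with value 1 at t = 1. *)
Lemma tangent_onto_not_expanding (F : fieldType) n l c k a (P : 'I_n -> 'M[F]_(l, k))
    (X : 'I_n -> 'M[F]_(c, a)) (Y : 'I_n -> 'M[F]_(l + c, k + a)) :
  has_nonroots F -> tangent_onto P X -> ((k + a) * l < (l + c) * k)%N ->
  ~ expanding (k + a) (l + c) (fun i => (Y i)^T).
Proof.
move=> Finf PX ltlk eY.
have [N [T [N0 cT]]] := expanding_corank_small Finf eY (isT : 0 < 2)%N.
pose Y1 i := block_mx (P i) 0 0 (X i).
pose Yt i := map_mx polyC (Y1 i) + 'X *: map_mx polyC (Y i - Y1 i).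
pose Tp i := map_mx polyC (T i).
set A := sandwich_mx T (fun i => (Y i)^T) in cT.
have [R [C RC]] := rank_corner A.
pose Dt (Z : 'I_n -> 'M[{poly F}]_(_, _)) :=
  \det (map_mx polyC R *m sandwich_mx Tp (fun i => (Z i)^T) *m map_mx polyC C).
have DtE Z s : (Dt Z).[s] =
    \det (R *m sandwich_mx T (fun i => (map_mx (horner_eval s) (Z i))^T) *m C).
  have -> : (fun i => (map_mx (horner_eval s) (Z i))^T) =
      (fun i => map_mx (horner_eval s) (Z i)^T) by apply: funext => i; rewrite map_trmx.
  have TE : T = fun i => map_mx (horner_eval s) (Tp i) by apply: funext => i; rewrite map_horner_polyC.
  by rewrite [in RHS]TE -map_sandwich_mx -horner_evalE -det_map_mx !map_mxM !map_horner_polyC.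
have D1 : (Dt Yt).[1] = 1.
  rewrite DtE (_ : (fun i => _) = fun i => (Y i)^T); last first.
    apply: funext => i; rewrite map_mxD map_mxZ /= !map_horner_polyC.
    by rewrite /horner_eval hornerX scale1r addrCA subrr addr0.
  by rewrite RC det1.
have D0 : Dt Yt != 0 by apply/eqP => h; move: D1; rewrite h horner0 => /esym/eqP; rewrite oner_eq0.
(* The precision exceeds the degree of the minor. *)
have [u [w [E HE]]] := hensel_lift PX Y (size (Dt Yt)).
set M := size _ in HE.
pose Y' i := Yt i - 'X^M *: block_mx 0 0 (E i) 0.
have Y'0 i : row_mx u 1%:M *m Y' i *m col_mx 1%:M w = 0.
  rewrite mulmxBr mulmxBl HE -scalemxAr -scalemxAl mul_row_block mul_row_col.
  by rewrite !(mulmx0, mul0mx, mul1mx, mulmx1, addr0, add0r) subrr.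
have D'0 : Dt Y' = 0.
  apply: contrapT => /eqP /Finf [s /eqP]; apply; rewrite DtE.
  set Z := fun i => _; apply: contraTeq (_ : \rank (sandwich_mx T Z) < \rank A)%N => [h|].
    by rewrite -leqNgt; exact: rank_corner_det h.
  pose us := map_mx (horner_eval s) u; pose ws := map_mx (horner_eval s) w.
  pose B := (col_mx 1%:M ws)^T : 'M_(k, k + a).
  have rB : \rank B = k.
    apply/eqP; rewrite -[_ == _]/(row_free B); apply/row_freeP.
    by exists (row_mx 1%:M 0)^T; rewrite -trmx_mul mul_row_col mul1mx mul0mx addr0 trmx1.
  have rI : (\rank (image_space B Z) <= l)%N.
    pose K := (row_mx us 1%:M)^T.
    have : (image_space B Z <= kermx K)%MS.
      apply/sumsmx_subP => i _; rewrite genmxE; apply/sub_kermxP.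
      rewrite -mulmxA /Z -!trmx_mul.
      have := congr1 (map_mx (horner_eval s)) (Y'0 i).
      by rewrite !map_mxM map_row_mx map_col_mx !map_mx1 !map_mx0 => ->; rewrite trmx0.
    move=> /mxrankS; rewrite mxrank_ker.
    suff -> : \rank K = c by rewrite addnK.
    rewrite /K mxrank_tr; apply/eqP; rewrite -[_ == _]/(row_free _); apply/row_freeP.
    by exists (col_mx 0 1%:M); rewrite mul_row_col mulmx0 mul1mx add0r.
  have := corank_ge T Z B; rewrite rB => h.
  have := corankE T Z; have := corankE T (fun i => (Y i)^T); rewrite -/A => h1 h2.
  have : ((k + a) * N * \rank (image_space B Z) <= (k + a) * N * l)%N by rewrite leq_mul2l rI orbT.
  have : ((k + a) * l * N < (l + c) * k * N)%N by rewrite ltn_pmul2r.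
  have : ((k + a) * l * N + N <= (l + c) * k * N)%N by rewrite addnC -mulSn leq_mul2r ltlk orbT.
  move: cT h h1 h2; rewrite /A; move: (corank _ _) (corank _ _) (\rank _) (\rank _) (\rank _).
  move=> x1 x2 x3 x4 x5; clear -N0.
  rewrite ![(_ * N * k)%N]mulnAC ![(_ * N * l)%N]mulnAC ![(_ * N * x5)%N]mulnAC.
  move: ((l + c) * k * N)%N ((k + a) * l * N)%N ((k + a) * x5 * N)%N => z1 z2 z3.
  by move: (_ * (k + a))%N => z4; lia.
have [y Dy] : exists y, Dt Yt = Dt Y' + 'X^M * y.
  have -> : Dt Yt = \det (map_mx polyC R *m sandwich_mx Tp (fun i => (Y' i)^T) *m map_mx polyC C +
      'X^M *: (map_mx polyC R *m sandwich_mx Tp (fun i => (block_mx 0 0 (E i) 0)^T) *m map_mx polyC C)).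
    have YE : (fun i => (Yt i)^T) = fun i => (Y' i)^T + 'X^M *: (block_mx 0 0 (E i) 0)^T.
      by apply: funext => i; rewrite -linearZ -linearD /= subrK.
    by rewrite /Dt YE sandwich_mx_liner mulmxDr mulmxDl -scalemxAr -scalemxAl.
  exact: det_line.
have y0 : y != 0 by apply: contraNneq D0 => h; rewrite Dy D'0 h mulr0 addr0.
have : (size (Dt Yt) = M + size y)%N.
  by rewrite Dy D'0 add0r mulrC size_mulXn // addnC.
by move/eqP; rewrite -/M -{1}[M]addn0 eqn_add2l eq_sym size_poly_eq0 (negPf y0).
Qed.

(** * Cut-and-paste rank as tangent surjectivity *)

Section TensorVec.
Variable F : fieldType.

(** Vectorization in the index order of the Kronecker product. *)
Definition tvec c d (G : 'M[F]_(c, d)) : 'rV_(c * d) :=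
  \row_k G (mxtens_unindex k).1 (mxtens_unindex k).2.

Lemma tvecE c d (G : 'M[F]_(c, d)) i j : tvec G 0 (mxtens_index (i, j)) = G i j.
Proof. by rewrite mxE mxtens_indexK. Qed.

Lemma tvec_onto c d (u : 'rV[F]_(c * d)) : exists G : 'M_(c, d), u = tvec G.
Proof.
exists (\matrix_(i, j) u 0 (mxtens_index (i, j))); apply/rowP => k.
by case: (mxtens_indexP k) => i j; rewrite tvecE mxE.
Qed.

Lemma tvec0 c d : tvec (0 : 'M[F]_(c, d)) = 0.
Proof. by apply/rowP => k; rewrite !mxE. Qed.

Lemma tvec_inj c d : injective (@tvec c d).
Proof.
move=> G H E; apply/matrixP => i j.
by have := congr1 (fun u : 'rV_(c * d) => u 0 (mxtens_index (i, j))) E; rewrite /= !tvecE.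
Qed.

Lemma tvec_mul c a d b (G : 'M[F]_(c, d)) (X : 'M_(c, a)) (Z : 'M_(d, b)) :
  tvec G *m (X *t Z) = tvec (X^T *m G *m Z).
Proof.
apply/rowP => k; case: (mxtens_indexP k) => i j; rewrite tvecE !mxE.
rewrite (reindex (@mxtens_index c d)) /=; last first.
  by exists (@mxtens_unindex c d) => z _; rewrite ?mxtens_indexK ?mxtens_unindexK.
under [RHS]eq_bigr do rewrite mxE mulr_suml.
rewrite exchange_big pair_bigA /=; apply: eq_bigr => -[x y] _ /=.
by rewrite tvecE tensmxE mxE mulrAC mulrA mulrAC [G _ _ * _]mulrC.
Qed.

Lemma tvec_mul_sum n c a d b (G : 'M[F]_(c, d)) (X : 'I_n -> 'M_(c, a)) (Z : 'I_n -> 'M_(d, b)) :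
  tvec G *m (\sum_i X i *t Z i) = tvec (\sum_i (X i)^T *m G *m Z i).
Proof.
rewrite mulmx_sumr; under eq_bigr do rewrite tvec_mul.
by apply/rowP => k; rewrite summxE !mxE summxE; apply: eq_bigr => i _; rewrite mxE.
Qed.

(** Row freeness of the sum of Kronecker products is injectivity of the adjoint
    map G |-> sum_i X_i^T G Z_i. *)
Lemma tens_row_freeP n c a d b (X : 'I_n -> 'M[F]_(c, a)) (Z : 'I_n -> 'M_(d, b)) :
  reflect (forall G, \sum_i (X i)^T *m G *m Z i = 0 -> G = 0)
    (row_free (\sum_i X i *t Z i)%R).
Proof.
apply: (iffP idP) => [fM G XGZ|inj].
  apply: tvec_inj; apply: (row_free_inj fM).
  by rewrite !tvec_mul_sum XGZ; congr tvec; rewrite big1 // => i _; rewrite mulmx0 mul0mx.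
rewrite -kermx_eq0 -submx0; apply/rV_subP => u /sub_kermxP.
have [G ->] := tvec_onto u; rewrite tvec_mul_sum -(tvec0 a b) => /tvec_inj /inj ->.
by rewrite tvec0 sub0mx.
Qed.

Lemma tens_row_free_onto n c a d b (X : 'I_n -> 'M[F]_(c, a)) (Z : 'I_n -> 'M_(d, b)) G :
  row_free (\sum_i X i *t Z i)%R -> exists W, \sum_i X i *m W *m (Z i)^T = G.
Proof.
move=> /row_freeP[D MD]; have [W DW] := tvec_onto (tvec G *m D^T); exists W.
apply: tvec_inj; transitivity (tvec W *m (\sum_i (X i)^T *t (Z i)^T)).
  by rewrite tvec_mul_sum; congr tvec; apply: eq_bigr => i _; rewrite trmxK.
rewrite -DW -mulmxA; set M := \sum_i _ in MD *.
have -> : \sum_i (X i)^T *t (Z i)^T = M^T.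
  by rewrite /M [RHS]raddf_sum; apply: eq_bigr => i _; rewrite /= trmx_tens.
by rewrite -trmx_mul MD trmx1 mulmx1.
Qed.

Lemma tens_row_free_left n c a d b (X : 'I_n -> 'M[F]_(c, a)) (Z : 'I_n -> 'M_(d, b)) :
  (0 < d)%N -> row_free (\sum_i X i *t Z i)%R -> row_free (\mxrow_i X i).
Proof.
case: d Z => // d Z _ /tens_row_freeP inj.
rewrite -kermx_eq0 -submx0; apply/rV_subP => u /sub_kermxP uX.
suff : u^T *m (delta_mx 0 0 : 'rV_d.+1) = 0.
  move=> /matrixP u0; rewrite (_ : u = 0) ?sub0mx //; apply/rowP => i.
  by have := u0 i 0; rewrite mxE big_ord1 !mxE !eqxx mulr1.
apply: inj; rewrite big1 // => i _.
have : u *m X i = 0 by rewrite -[X i](mxrowK X i) mul_submxrow uX submxrow0.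
by rewrite mulmxA -trmx_mul => ->; rewrite trmx0 !mul0mx.
Qed.

Lemma tens_row_free_right n c a d b (X : 'I_n -> 'M[F]_(c, a)) (Z : 'I_n -> 'M_(d, b)) :
  (0 < c)%N -> row_free (\sum_i X i *t Z i)%R -> row_free (\mxrow_i Z i).
Proof.
case: c X => // c X _ /tens_row_freeP inj.
rewrite -kermx_eq0 -submx0; apply/rV_subP => u /sub_kermxP uZ.
suff : (delta_mx 0 0 : 'cV_c.+1) *m u = 0.
  move=> /matrixP u0; rewrite (_ : u = 0) ?sub0mx //; apply/rowP => i.
  by have := u0 0 i; rewrite mxE big_ord1 !mxE !eqxx mul1r.
apply: inj; rewrite big1 // => i _.
have : u *m Z i = 0 by rewrite -[Z i](mxrowK Z i) mul_submxrow uZ submxrow0.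
by rewrite -!mulmxA => ->; rewrite !mulmx0.
Qed.

(** Let the rows of P span the orthogonal of the rows of Z = (Z_1 | ... | Z_n).
    A tuple E, modulo the tuples u P, is determined by sum_i E_i Z_i^T, and
    full rank of the sum of Kronecker products says that this value is
    attained by a tuple X_i w. *)
Lemma tens_tangent_onto n l c k a d (X : 'I_n -> 'M[F]_(c, a)) (Z : 'I_n -> 'M_(d, k)) :
  (0 < c)%N -> (d + l = n * k)%N -> row_free (\sum_i X i *t Z i)%R ->
  exists P : 'I_n -> 'M_(l, k), tangent_onto P X.
Proof.
move=> c0 dl fM; have fZ := tens_row_free_right c0 fM.
set Zr := \mxrow_i Z i in fZ.
have rK : \rank (kermx Zr^T) = l.
  rewrite mxrank_ker mxrank_tr; move/eqP: fZ => ->.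
  by rewrite sum_nat_const card_ord -dl addKn.
have [Pm _ KP] : exists2 Pm : 'M_(l, \sum_(i < n) k), True & (kermx Zr^T <= Pm)%MS.
  by rewrite -rK; exists (row_base (kermx Zr^T)); rewrite ?eq_row_base.
exists (submxrow Pm) => E.
have [w XwZ] := tens_row_free_onto (\sum_i E i *m (Z i)^T) fM.
have /submxP[u uP] : (\mxrow_i (E i - X i *m w) <= Pm)%MS.
  apply: submx_trans KP; apply/sub_kermxP; rewrite tr_mxrow mul_mxrow_mxcol.
  by under eq_bigr do rewrite mulmxBl; rewrite sumrB XwZ subrr.
exists u, w => i; rewrite mul_submxrow -uP mxrowK.
by rewrite subrK.
Qed.

End TensorVec.

Section CutPaste.
Variable R : realType.

(** The maximum is attained, so a full value is a full rank. *)
Lemma cp_fullP n a b c d : cp R n a b c d = (c * d)%N <->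
  exists (X : 'I_n -> 'M[R]_(c, a)) (Z : 'I_n -> 'M[R]_(d, b)), row_free (\sum_i X i *t Z i)%R.
Proof.
pose P (r : 'I_(c * d).+1) := `[< exists (X : 'I_n -> 'M[R]_(c, a)) (Z : 'I_n -> 'M[R]_(d, b)),
  \rank (\sum_i X i *t Z i)%R = r :> nat >].
rewrite -[cp R n a b c d]/(\max_(r < (c * d).+1 | P r) nat_of_ord r).
split=> [|[X [Z fM]]].
  have [|r Pr ->] := @eq_bigmax_cond _ P (fun r => nat_of_ord r).
    apply/card_gt0P; exists ord0; apply/asboolP; exists (fun=> 0), (fun=> 0).
    by rewrite big1 ?mxrank0 // => i _; rewrite tens0mx.
  move/asboolP: Pr => [X [Z rM]] rE; exists X, Z.
  by rewrite /row_free rM rE.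
apply/eqP; rewrite eqn_leq; apply/andP; split.
  by apply/bigmax_leqP => r _; rewrite -ltnS.
apply: (@leq_bigmax_cond _ _ (fun r => nat_of_ord r) ord_max).
by apply/asboolP; exists X, Z; exact/eqP.
Qed.

End CutPaste.

(** * Specializing rational functions *)

Lemma base_digits_inj d N (m1 m2 : 'I_N -> nat) :
  (forall i, m1 i < d)%N -> (forall i, m2 i < d)%N ->
  (\sum_i m1 i * d ^ i)%N = (\sum_i m2 i * d ^ i)%N -> m1 =1 m2.
Proof.
elim: N m1 m2 => [|N IH] m1 m2 lt1 lt2; first by move=> _ [].
have E (m : 'I_N.+1 -> nat) : (\sum_i m i * d ^ i)%N =
    ((\sum_(i < N) m (lift ord0 i) * d ^ i) * d + m ord0)%N.
  rewrite big_ord_recl expn0 muln1 addnC big_distrl /=; congr (_ + _)%N.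
  by apply: eq_bigr => i _; rewrite /bump /= add1n expnSr mulnA.
have d0 : (0 < d)%N := leq_ltn_trans (leq0n _) (lt1 ord0).
rewrite !E => H.
have e0 : m1 ord0 = m2 ord0.
  by have := congr1 (modn^~ d) H; rewrite /= !modnMDl !modn_small.
have H' := congr1 (divn^~ d) H; rewrite /= !divnMDl // !divn_small // !addn0 in H'.
move=> i; have [j ->|->] := unliftP ord0 i; last exact: e0.
by apply: (IH (fun i => m1 (lift ord0 i)) (fun i => m2 (lift ord0 i))).
Qed.

Section Generic.
Variable F : fieldType.
Hypothesis Finf : has_nonroots F.

(** Kronecker substitution: replacing the i-th variable by the d^i-th power of
    one variable, with d above all exponents, keeps monomials distinct. *)
Lemma mpoly_nonroot N (p : mpoly.mpoly N F) :
  p != 0 -> exists v, mpoly.meval v p != 0.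
Proof.
move=> p0; pose d := mpoly.mmeasure mpoly.mdeg p.
pose e (m : mpoly.multinom N) := (\sum_i m i * d ^ i)%N.
pose q : {poly F} := \sum_(m <- mpoly.msupp p) mpoly.mcoeff m p *: 'X^(e m).
have ltd m i : m \in mpoly.msupp p -> (m i < d)%N.
  move=> /mpoly.msize_mdeg_lt; apply: leq_ltn_trans.
  by rewrite mpoly.mdegE (bigD1 i) //= leq_addr.
have [m0 m0p] : exists m0, m0 \in mpoly.msupp p.
  case E: (mpoly.msupp p) => [|m s]; last by exists m; rewrite inE eqxx.
  by move: p0; rewrite -mpoly.msupp_eq0 E.
have q0 : q != 0.
  apply/eqP => /(congr1 (fun q : {poly F} => q`_(e m0))); rewrite coef0 coef_sum.
  rewrite (bigD1_seq m0) ?mpoly.msupp_uniq //= big_seq_cond big1 => [|m /andP[mp mm0]].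
    by rewrite coefZ coefXn eqxx mulr1 addr0 => /eqP; rewrite mpoly.mcoeff_eq0 m0p.
  rewrite coefZ coefXn; case: eqP => [E|]; last by rewrite mulr0.
  case/eqP: mm0; apply/mpoly.mnmP.
  by apply: (@base_digits_inj d) => [i|i|]; rewrite ?ltd.
have [s qs] := Finf q0; exists (fun i => s ^+ (d ^ i)).
suff -> : mpoly.meval (fun i => s ^+ (d ^ i)) p = q.[s] by [].
rewrite mpoly.mevalE horner_sum; apply: eq_bigr => m _.
rewrite hornerZ hornerXn; congr (_ * _); rewrite /e expr_sum.
by apply: eq_bigr => i _; rewrite -exprM mulnC.
Qed.

End Generic.

Section Fractions.
Variable A : idomainType.
Notation K := {fraction A}.
Notation tofrac := (@FracField.tofrac A).

Lemma fraction_quotient (x : K) : exists a b, b != 0 /\ x * tofrac b = tofrac a.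
Proof.
elim/quotP: x => x _; exists (frac x).1, (frac x).2; split; first exact: denom_ratioP.
apply/eqP; unlock FracField.tofrac; rewrite -[X in X == _]FracField.pi_mul.
apply/eqP/eqmodP; rewrite /= FracField.equivfE /FracField.mulf /=.
by rewrite !numden_Ratio ?(mulf_neq0, oner_neq0, denom_ratioP, mulr1) // mulrC.
Qed.

Lemma clear_denominators m n (M : 'M[K]_(m, n)) :
  exists (g : A) (M' : 'M[A]_(m, n)), g != 0 /\ map_mx tofrac M' = tofrac g *: M.
Proof.
have /boolp.choice[f Hf] (ij : 'I_m * 'I_n) :
    exists ab : A * A, ab.2 != 0 /\ M ij.1 ij.2 * tofrac ab.2 = tofrac ab.1.
  by have [a [b [b0 E]]] := fraction_quotient (M ij.1 ij.2); exists (a, b).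
pose g := \prod_ij (f ij).2.
exists g, (\matrix_(i, j) ((f (i, j)).1 * \prod_(ij | ij != (i, j)) (f ij).2)); split.
  by apply/prodf_neq0 => ij _; case: (Hf ij).
apply/matrixP => i j; rewrite !mxE /g [in RHS](bigD1 (i, j)) //= !tofracM.
by have [_ <-] := Hf (i, j); rewrite -mulrA mulrC.
Qed.

End Fractions.

(** * The generic tuple *)

Lemma map_mx_derivM (A : comNzRingType) (d : {additive A -> A}) m n p
    (M : 'M[A]_(m, n)) (N : 'M[A]_(n, p)) :
  (forall x y, d (x * y) = d x * y + x * d y) ->
  map_mx d (M *m N) = map_mx d M *m N + M *m map_mx d N.
Proof.
move=> dM; apply/matrixP => i j; rewrite !mxE raddf_sum -big_split /=.
by apply: eq_bigr => l _; rewrite dM !mxE.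
Qed.

Lemma map_mx_deriv_mul3 (A S : comNzRingType) (f : {rmorphism A -> S}) (d : {additive A -> A})
    c m p k (C : 'M[A]_(c, m)) (Y : 'M[A]_(m, p)) (B : 'M[A]_(p, k)) :
  (forall x y, d (x * y) = d x * y + x * d y) ->
  map_mx f (map_mx d (C *m Y *m B)) =
    map_mx f (map_mx d C) *m map_mx f Y *m map_mx f B +
    map_mx f C *m map_mx f (map_mx d Y) *m map_mx f B +
    map_mx f C *m map_mx f Y *m map_mx f (map_mx d B).
Proof. by move=> dM; rewrite !map_mx_derivM // mulmxDl !map_mxD !map_mxM. Qed.

Lemma map_tofrac_inj (A : idomainType) m n :
  injective (@map_mx _ _ (@FracField.tofrac A) m n).
Proof.
move=> M N /matrixP E; apply/matrixP => i j; have := E i j; rewrite !mxE => /eqP.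
by rewrite tofrac_eq => /eqP.
Qed.

Section GenericPoint.
Variables (F : fieldType) (N : nat).
Hypothesis F0 : [pchar F] =i pred0.
Notation A := (mpoly.mpoly N F).
Notation K := {fraction A}.
Notation tofrac := (@FracField.tofrac A).

Lemma fraction_mpoly_has_nonroots : has_nonroots K.
Proof.
apply: pchar0_has_nonroots; apply/pcharf0P => i.
rewrite -(rmorph_nat tofrac) tofrac_eq0 -((pcharf0P F).1 F0 i).
apply/eqP/eqP => [|i0].
  by move=> /(congr1 (mpoly.meval (fun=> 0))); rewrite rmorph_nat rmorph0.
by rewrite -(rmorph_nat (@mpoly.mpolyC N F)) i0 rmorph0.
Qed.

(** Clearing denominators in R M C = 1 leaves a polynomial g; wherever g does
    not vanish the corner of M stays invertible. *)
Lemma rank_specialize m n (M : 'M[A]_(m, n)) :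
  exists2 g : A, g != 0 & forall v, mpoly.meval v g != 0 ->
    (\rank (map_mx tofrac M) <= \rank (map_mx (mpoly.meval v) M))%N.
Proof.
have [R [C RC]] := rank_corner (map_mx tofrac M).
have [g1 [R' [g10 RE]]] := clear_denominators R.
have [g2 [C' [g20 CE]]] := clear_denominators C.
exists (g1 * g2) => [|v gv]; first exact: mulf_neq0.
have E : R' *m M *m C' = (g1 * g2)%:M.
  apply: map_tofrac_inj; rewrite !map_mxM RE CE map_scalar_mx rmorphM /=.
  by rewrite -scalemxAl -scalemxAl -scalemxAr RC scalerA scalemx1.
apply: (@rank_corner_det _ _ _ _ _ (map_mx (mpoly.meval v) R') (map_mx (mpoly.meval v) C')).
by rewrite -!map_mxM E map_scalar_mx det_scalar expf_neq0.
Qed.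

End GenericPoint.

Section GenericTuple.
Variables (F : fieldType) (n m1 m2 : nat).
Hypothesis F0 : [pchar F] =i pred0.
Notation N := #|{: 'I_n * 'I_m1 * 'I_m2}|.
Notation A := (mpoly.mpoly N F).
Notation K := {fraction A}.
Notation tofrac := (@FracField.tofrac A).

Definition generic_tuple (i : 'I_n) : 'M[A]_(m1, m2) :=
  \matrix_(x, y) mpoly.mpolyX F (mpoly.mnm1 (enum_rank (i, x, y))).

Lemma deriv_generic_tuple i0 x0 y0 i :
  map_mx (mpoly.mderiv (enum_rank (i0, x0, y0))) (generic_tuple i) =
  if i == i0 then delta_mx x0 y0 else 0.
Proof.
apply/matrixP => x y; rewrite !mxE mpoly.mderivX mpoly.mnm1E.
rewrite (inj_eq enum_rank_inj) !xpair_eqE.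
case: (eqVneq i i0) => [->|ne]; rewrite /= ?mxE ?scale0r //.
case: (eqVneq x x0) => [->|nx]; rewrite /= ?scale0r //.
case: (eqVneq y y0) => [->|ny]; rewrite /= ?scale0r //.
rewrite scale1r (_ : mpoly.mnm_sub _ _ = mpoly.mnm0).
  by rewrite mpoly.mpolyX0.
by apply/mpoly.mnmP => j; rewrite mpoly.mnmBE mpoly.mnm0E subnn.
Qed.

(** A certificate over the function field, cleared of denominators, remains a
    certificate at a point where some polynomial does not vanish, and would
    make a tuple over F expanding. *)
Lemma generic_not_expanding :
  (forall Y : 'I_n -> 'M[F]_(m1, m2), ~ expanding m2 m1 (fun i => (Y i)^T)) ->
  ~ expanding m2 m1 (fun i => (map_mx tofrac (generic_tuple i))^T).
Proof.
move=> nexpF /(@expanding_corank_small _ (@fraction_mpoly_has_nonroots F _ F0)).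
move=> /(_ 2 isT) [N0 [T [N00 cT]]].
have /boolp.choice[f Hf] (i : 'I_n) : exists gT : A * 'M[A]_(m2 * N0, m1 * N0),
    gT.1 != 0 /\ map_mx tofrac gT.2 = tofrac gT.1 *: T i.
  by have [g [T' H]] := clear_denominators (T i); exists (g, T').
pose g := \prod_i (f i).1; pose T' i := (\prod_(j | j != i) (f j).1) *: (f i).2.
have g0 : g != 0 by apply/prodf_neq0 => i _; case: (Hf i).
have T'E i : map_mx tofrac (T' i) = tofrac g *: T i.
  rewrite /T' map_mxZ (Hf i).2 scalerA /g [in RHS](bigD1 i) //= tofracM.
  by congr (_ *: _); rewrite mulrC.
pose M := sandwich_mx T' (fun i => (generic_tuple i)^T).
have rM : \rank (map_mx tofrac M) =
    \rank (sandwich_mx T (fun i => (map_mx tofrac (generic_tuple i))^T)).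
  rewrite map_sandwich_mx (_ : (fun i => map_mx tofrac (generic_tuple i)^T) =
      fun i => (map_mx tofrac (generic_tuple i))^T); last first.
    by apply: funext => i; rewrite map_trmx.
  rewrite (_ : (fun i => map_mx tofrac (T' i)) = fun i => 0 + tofrac g *: T i); last first.
    by apply: funext => i; rewrite T'E add0r.
  rewrite (@sandwich_mx_linel _ _ _ _ _ _ (fun=> 0)) (_ : sandwich_mx (fun=> 0) _ = 0).
    by rewrite add0r (eqmx_scale _ _) // tofrac_eq0.
  by rewrite /sandwich_mx big1 // => i _; rewrite linear0 mul0mx.
have [h h0 Hh] := @rank_specialize F N _ _ M.
have [v hv] := mpoly_nonroot (pchar0_has_nonroots F0) h0.
pose Y i := map_mx (mpoly.meval v) (generic_tuple i).
apply: (nexpF Y) => r B; rewrite leqNgt; apply/negP => lt.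
have := Hh v hv; rewrite rM map_sandwich_mx.
rewrite (_ : (fun i => map_mx (mpoly.meval v) (generic_tuple i)^T) = fun i => (Y i)^T); last first.
  by apply: funext => i; rewrite /Y map_trmx.
set Tv := fun i => map_mx _ (T' i) => le_rk.
have c1 := corank_ge Tv (fun i => (Y i)^T) B.
have c2 := corankE Tv (fun i => (Y i)^T).
have c3 := corankE T (fun i => (map_mx tofrac (generic_tuple i))^T).
move: cT le_rk c1 c2 c3 lt; move: (corank _ _) (corank _ _) (\rank _) (\rank _) (\rank _) (\rank _).
move=> x1 x2 x3 x4 x5 x6; clear -N00 => c1 c2 c3 c4 c5 c6.
have : (m2 * x3 * N0 + N0 <= m1 * x4 * N0)%N by rewrite addnC -mulSn leq_mul2r c6 orbT.
move: c3; rewrite ![(_ * N0 * x4)%N]mulnAC ![(_ * N0 * x3)%N]mulnAC.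
move: (m2 * x3 * N0)%N (m1 * x4 * N0)%N => z1 z2.
move: c4 c5; move: (_ * m2)%N => z3; lia.
Qed.


(** The dual of surjectivity: a tuple H orthogonal to all tuples
    C' Y_i B^T + C Y_i B'^T, with C' and B' arbitrary, vanishes. *)
Definition cotangent_free c k (C : 'M[F]_(c, m1)) (B : 'M[F]_(k, m2))
    (Y : 'I_n -> 'M[F]_(m1, m2)) :=
  forall H : 'I_n -> 'M[F]_(c, k),
    \sum_i H i *m (B *m (Y i)^T) = 0 -> \sum_i (Y i)^T *m C^T *m H i = 0 ->
    forall i, H i = 0.

(** Differentiating C Y_i B^T = 0 with respect to the (x, y) entry of Y_i0
    expresses the tuple whose i0-th member is C delta_xy B^T, the others being
    zero, as a combination of tuples C' Y_i B^T and C Y_i B'^T.  A tuple H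
    orthogonal to the latter is thus orthogonal to all C delta_xy B^T, which
    span everything as C and B have full row rank. *)
Lemma generic_cotangent_free c k (C : 'M[A]_(c, m1)) (B : 'M[A]_(k, m2)) :
  (forall i, C *m generic_tuple i *m B^T = 0) ->
  row_free (map_mx tofrac C) -> row_free (map_mx tofrac B) ->
  exists (C' : 'M[F]_(c, m1)) (B' : 'M[F]_(k, m2)) (Y : 'I_n -> 'M[F]_(m1, m2)),
  [/\ row_free C', row_free B', forall i, C' *m Y i *m B'^T = 0 & cotangent_free C' B' Y].
Proof.
move=> CYB fC fB.
have [gC gC0 HC] := @rank_specialize F N _ _ C.
have [gB gB0 HB] := @rank_specialize F N _ _ B.
have [v] := mpoly_nonroot (pchar0_has_nonroots F0) (mulf_neq0 gC0 gB0).
rewrite rmorphM mulf_eq0 negb_or => /andP[/HC rC /HB rB].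
rewrite (eqP fC) in rC; rewrite (eqP fB) in rB.
pose ev p q (M : 'M[A]_(p, q)) : 'M[F]_(p, q) := map_mx (mpoly.meval v) M.
have fC' : row_free (ev _ _ C) by rewrite /row_free eqn_leq rank_leq_row.
have fB' : row_free (ev _ _ B) by rewrite /row_free eqn_leq rank_leq_row.
pose Y i := ev _ _ (generic_tuple i).
exists (ev _ _ C), (ev _ _ B), Y; split=> //.
  move=> i; have := congr1 (ev _ _) (CYB i).
  by rewrite /Y /ev !map_mxM map_trmx map_mx0.
move=> H HBY YCH i0.
suff BHC : (ev _ _ B)^T *m (H i0)^T *m ev _ _ C = 0.
  have BH : (ev _ _ B)^T *m (H i0)^T = 0 by apply: (row_free_inj fC'); rewrite BHC mul0mx.
  apply: (row_free_inj fB'); rewrite mul0mx; apply: trmx_inj.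
  by rewrite trmx_mul BH trmx0.
apply: trace_delta_eq0 => x y.
pose d : {additive A -> A} := @mpoly.mderiv N F (enum_rank (i0, x, y)).
have dM p q : d (p * q) = d p * q + p * d q by exact: mpoly.mderivM.
have dY i : map_mx d (generic_tuple i) = if i == i0 then delta_mx x y else 0.
  exact: deriv_generic_tuple.
have dC i : ev _ _ (map_mx d C) *m Y i *m (ev _ _ B)^T +
   (if i == i0 then ev _ _ C *m delta_mx x y *m (ev _ _ B)^T else 0) +
   ev _ _ C *m Y i *m (ev _ _ (map_mx d B))^T = 0.
  have := map_mx_deriv_mul3 (@mpoly.meval N F v) C (generic_tuple i) B^T dM.
  rewrite CYB map_mx0 map_mx0 dY -map_trmx -!map_trmx => E.
  rewrite /Y /ev [RHS]E; congr (_ + _ + _).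
  by case: eqP => _; rewrite ?map_delta_mx // map_mx0 mulmx0 mul0mx.
have : \sum_i \tr ((H i)^T *m (ev _ _ (map_mx d C) *m Y i *m (ev _ _ B)^T +
   (if i == i0 then ev _ _ C *m delta_mx x y *m (ev _ _ B)^T else 0) +
   ev _ _ C *m Y i *m (ev _ _ (map_mx d B))^T)) = 0.
  by rewrite big1 // => i _; rewrite dC mulmx0 mxtrace0.
under eq_bigr do rewrite !mulmxDr !mxtraceD.
rewrite !big_split /= [X in _ + X + _](bigD1 i0) //= eqxx.
rewrite [X in _ + (_ + X) + _]big1 ?addr0 => [|i /negPf ->]; last by rewrite mulmx0 mxtrace0.
rewrite [X in X + _ + _](_ : _ = 0) ?add0r; last first.
  transitivity (\tr (ev _ _ (map_mx d C) *m (\sum_i H i *m (ev _ _ B *m (Y i)^T))^T)).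
    rewrite [(\sum_i _)^T]raddf_sum mulmx_sumr raddf_sum; apply: eq_bigr => i _ /=.
    by rewrite !trmx_mul trmxK mxtrace_mulC !mulmxA.
  by rewrite HBY trmx0 mulmx0 mxtrace0.
rewrite [X in _ + X](_ : _ = 0) ?addr0; last first.
  transitivity (\tr ((\sum_i (Y i)^T *m (ev _ _ C)^T *m H i)^T *m (ev _ _ (map_mx d B))^T)).
    rewrite [(\sum_i _)^T]raddf_sum mulmx_suml raddf_sum; apply: eq_bigr => i _ /=.
    by rewrite !trmx_mul !trmxK !mulmxA.
  by rewrite YCH trmx0 mul0mx mxtrace0.
move=> h; rewrite -[RHS]h [RHS]mxtrace_mulC -!mulmxA [RHS]mxtrace_mulC.
by rewrite !mulmxA.
Qed.

(** The X_i are the C Y_i in coordinates complementary to B, and the rows of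
    (Z_1 | ... | Z_n) are independent linear relations among the rows of the
    matrices B Y_i^T; there are d of them as these rows lie in the kernel of
    C^T, of dimension at most l.  Then
    H_i = G Z_i satisfies both orthogonality conditions as soon as
    sum_i X_i^T G Z_i = 0. *)
Lemma cotangent_free_tens l c k a d (C : 'M[F]_(c, m1)) (B : 'M[F]_(k, m2))
    (Y : 'I_n -> 'M[F]_(m1, m2)) :
  row_free C -> row_free B -> (forall i, C *m Y i *m B^T = 0) -> cotangent_free C B Y ->
  (m1 <= l + c)%N -> (k + a = m2)%N -> (d + l <= n * k)%N ->
  exists (X : 'I_n -> 'M[F]_(c, a)) (Z : 'I_n -> 'M[F]_(d, k)), row_free (\sum_i X i *t Z i)%R.
Proof.
move=> fC fB CYB cot lc ka dl.
have [D _ DB] : exists2 D : 'M[F]_(a, m2), row_free D & (B^C <= D)%MS.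
  have rD : \rank (B^C)%MS = a by rewrite mxrank_compl (eqP fB) -ka addKn.
  by rewrite -rD; exists (row_base (B^C)%MS); rewrite ?row_base_free ?eq_row_base.
have full : row_full (col_mx B D).
  rewrite -sub1mx; apply: submx_trans (_ : (B + B^C <= _)%MS).
    by rewrite sub1mx addsmx_compl_full.
  by rewrite -addsmxE addsmxS.
pose S := \mxcol_i (B *m (Y i)^T).
have rS : (\rank S <= l)%N.
  have : (S <= kermx C^T)%MS.
    apply/sub_kermxP; rewrite /S mxcol_mul -[RHS]mxcol0; apply/eq_mxcolP => i.
    by apply: trmx_inj; rewrite !trmx_mul !trmxK mulmxA CYB trmx0.
  by move=> /mxrankS; rewrite mxrank_ker mxrank_tr (eqP fC); lia.
have [Zr fZ ZS] : exists2 Zr : 'M[F]_(d, \sum_(i < n) k), row_free Zr & (Zr <= kermx S)%MS.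
  apply: exists_free_rows; rewrite mxrank_ker; move: (\rank S) rS => s rS.
  by rewrite sum_nat_const card_ord; lia.
exists (fun i => C *m Y i *m D^T), (submxrow Zr); apply/tens_row_freeP => G XGZ.
have ZS0 : \sum_i submxrow Zr i *m (B *m (Y i)^T) = 0.
  by rewrite -mul_mxrow_mxcol submxrowK; apply/sub_kermxP.
have GZ i : G *m submxrow Zr i = 0.
  apply: (cot (fun i => G *m submxrow Zr i)).
    under eq_bigr do rewrite -mulmxA.
    by rewrite -mulmx_sumr ZS0 mulmx0.
  rewrite -[LHS]mul1mx -(mulVpmx full) -mulmxA; set V := \sum_i _.
  suff -> : col_mx B D *m V = 0 by rewrite mulmx0.
  rewrite mul_col_mx -[RHS](@col_mx0 F k a); congr col_mx.
    rewrite /V mulmx_sumr big1 // => i' _; rewrite !mulmxA.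
    suff -> : B *m (Y i')^T *m C^T = 0 by rewrite !mul0mx.
    by apply: trmx_inj; rewrite !trmx_mul !trmxK mulmxA CYB trmx0.
  rewrite -[RHS]XGZ /V mulmx_sumr; apply: eq_bigr => i' _.
  by rewrite !trmx_mul trmxK !mulmxA.
apply: (row_free_inj fZ); rewrite mul0mx -[Zr]submxrowK mul_mxrow -[RHS]mxrow0.
by apply/eq_mxrowP => i.
Qed.

(** A violating subspace of the generic tuple has some dimension k, and its
    image has dimension at most the l fixed by the two inequalities.  The rows
    of C are m1 - l independent functionals vanishing on that image. *)
Theorem not_expanding_tens :
  (forall Y : 'I_n -> 'M[F]_(m1, m2), ~ expanding m2 m1 (fun i => (Y i)^T)) ->
  (m1 <= n * m2)%N ->
  exists k l, [/\ (1 <= k <= m2)%N, (m2 * l < m1 * k)%N, (m1 * k <= m2 * l.+1)%N &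
   exists (X : 'I_n -> 'M[F]_(m1 - l, m2 - k)) (Z : 'I_n -> 'M[F]_(n * k - l, k)),
     row_free (\sum_i X i *t Z i)%R].
Proof.
move=> nexpF lem; have nexpK := generic_not_expanding nexpF.
have [r [B ltB]] : exists r (B : 'M[K]_(r, m2)),
   (m2 * \rank (image_space B (fun i => (map_mx tofrac (generic_tuple i))^T))
     < m1 * \rank B)%N.
  apply: contrapT => H; apply: nexpK => r B; rewrite leqNgt; apply/negP => h.
  by apply: H; exists r, B.
set W := image_space _ _ in ltB.
set k := \rank B in ltB *; pose l := ((m1 * k).-1 %/ m2)%N.
have m10 : (0 < m1 * k)%N by apply: leq_ltn_trans ltB.
have k0 : (0 < k)%N by move: m10; rewrite muln_gt0 => /andP[].
have km2 : (k <= m2)%N by exact: rank_leq_col.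
have m20 : (0 < m2)%N by apply: leq_trans km2.
have lW : (\rank W <= l)%N by rewrite leq_divRL // mulnC -ltnS prednK.
have l_lt : (m2 * l < m1 * k)%N by rewrite -[ltnRHS]prednK // ltnS mulnC leq_trunc_div.
have l_ge : (m1 * k <= m2 * l.+1)%N.
  by rewrite -[leqLHS]prednK // [leqRHS]mulnC; exact: ltn_ceil.
have l_m1 : (l < m1)%N.
  rewrite -(ltn_pmul2l m20); apply: leq_trans l_lt _.
  by rewrite [leqRHS]mulnC leq_mul2l km2 orbT.
have l_nk : (l < n * k)%N.
  rewrite -(ltn_pmul2l m20); apply: leq_trans l_lt _.
  by rewrite mulnA [(m2 * n)%N]mulnC leq_mul2r lem orbT.
exists k, l; rewrite k0 km2; split=> //.
have [C fC CW] : exists2 C : 'M[K]_(m1 - l, m1), row_free C & (C <= kermx W^T)%MS.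
  by apply: exists_free_rows; rewrite mxrank_ker mxrank_tr leq_sub2l.
have [gC [C' [gC0 C'E]]] := clear_denominators C.
have [gB [B' [gB0 B'E]]] := clear_denominators (row_base B).
have CYB i : C' *m generic_tuple i *m B'^T = 0.
  apply: map_tofrac_inj; rewrite !map_mxM map_mx0 -map_trmx C'E B'E.
  rewrite linearZ /= -scalemxAr -!scalemxAl.
  suff -> : C *m map_mx tofrac (generic_tuple i) *m (row_base B)^T = 0 by rewrite !scaler0.
  have /submxP[D ->] : (row_base B <= B)%MS by rewrite eq_row_base.
  apply: trmx_inj; rewrite !trmx_mul !trmxK trmx0 -mulmxA.
  rewrite (_ : B *m _ = 0) ?mulmx0 // mulmxA; apply/sub_kermxP.
  have : (W <= kermx C^T)%MS.
    apply/sub_kermxP; apply: trmx_inj; rewrite trmx_mul trmxK trmx0.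
    exact/sub_kermxP.
  apply: submx_trans; apply: (@sumsmx_sup _ _ i) => //.
  by rewrite genmxE.
have fC' : row_free (map_mx tofrac C').
  by rewrite /row_free C'E (eqmx_scale _ _) ?tofrac_eq0.
have fB' : row_free (map_mx tofrac B').
  by rewrite /row_free B'E (eqmx_scale _ _) ?tofrac_eq0 // -/(row_free _) row_base_free.
have [C1 [B1 [Y [fC1 fB1 CYB1 cot]]]] := generic_cotangent_free CYB fC' fB'.
apply: (cotangent_free_tens (l := l) fC1 fB1 CYB1 cot).
- by rewrite subnKC // ltnW.
- by rewrite subnKC.
- by rewrite subnK // ltnW.
Qed.

End GenericTuple.

(** * Non-expanding tuples have unbounded likelihood *)

Section Gram.
Variable R : realType.

Lemma diag_form m (D : 'rV[R]_m) (w : 'cV[R]_m) :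
  (w^T *m diag_mx D *m w) 0 0 = \sum_i D 0 i * w i 0 ^+ 2.
Proof.
rewrite mul_mx_diag mxE; apply: eq_bigr => i _; rewrite !mxE.
by rewrite [w i 0 * D 0 i]mulrC -mulrA.
Qed.

Lemma PD_congr m (P g : 'M[R]_m) : g \in unitmx -> PD R m P -> PD R m (g^T *m P *m g).
Proof.
move=> ug [Ps Pp]; split; first by rewrite !trmx_mul trmxK Ps mulmxA.
move=> v v0; have := Pp (g *m v); rewrite trmx_mul !mulmxA; apply.
by apply: contraNneq v0 => gv; rewrite -[v](mulKmx ug) gv mulmx0.
Qed.

Lemma PD_diag m (D : 'rV[R]_m) : (forall i, 0 < D 0 i) -> PD R m (diag_mx D).
Proof.
move=> D0; split; first exact: tr_diag_mx.
move=> v v0; rewrite diag_form lt0r sumr_ge0 ?andbT => [|i _]; last first.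
  by rewrite mulr_ge0 ?sqr_ge0 // ltW.
apply: contra v0 => /eqP h; apply/eqP/colP => i; rewrite mxE.
apply/eqP; rewrite -sqrf_eq0.
have /eqP : D 0 i * v i 0 ^+ 2 = 0.
  by apply: (psumr_eq0P _ h) => // j _; rewrite mulr_ge0 ?sqr_ge0 // ltW.
by rewrite mulf_eq0 gt_eqF.
Qed.

(** In the bases g and h that diagonalize both precision matrices the trace is
    a weighted sum of squares of the entries of g Y h^T. *)
Lemma trace_gram m p (g : 'M[R]_m) (h : 'M[R]_p) (mu : 'rV[R]_m) (lam : 'rV[R]_p)
    (Y : 'M[R]_(m, p)) :
  \tr ((g^T *m diag_mx mu *m g) *m (Y *m (h^T *m diag_mx lam *m h) *m Y^T)) =
  \sum_a \sum_j mu 0 a * lam 0 j * (g *m Y *m h^T) a j ^+ 2.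
Proof.
set M := g *m Y *m h^T.
transitivity (\tr (diag_mx mu *m M *m diag_mx lam *m M^T)).
  rewrite /M !trmx_mul trmxK -!mulmxA mxtrace_mulC -!mulmxA.
  by [].
rewrite /mxtrace; apply: eq_bigr => a _; rewrite mul_diag_mx mul_mx_diag mxE.
by apply: eq_bigr => j _; rewrite !mxE expr2; ring.
Qed.

Lemma trace_gram_sum n m p (g : 'M[R]_m) (h : 'M[R]_p) (mu : 'rV[R]_m) (lam : 'rV[R]_p)
    (Y : 'I_n -> 'M[R]_(m, p)) :
  \tr ((g^T *m diag_mx mu *m g) *m \sum_i (Y i *m (h^T *m diag_mx lam *m h) *m (Y i)^T)) =
  \sum_a \sum_j mu 0 a * lam 0 j * \sum_i (g *m Y i *m h^T) a j ^+ 2.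
Proof.
rewrite mulmx_sumr raddf_sum /=; under eq_bigr do rewrite trace_gram.
rewrite exchange_big /=; apply: eq_bigr => a _.
rewrite exchange_big /=; apply: eq_bigr => j _.
by rewrite mulr_sumr.
Qed.

Lemma det_gram m (g : 'M[R]_m) (mu : 'rV[R]_m) :
  \det (g^T *m diag_mx mu *m g) = \det g ^+ 2 * \prod_i mu 0 i.
Proof. by rewrite !det_mulmx det_tr det_diag expr2 mulrAC. Qed.

Lemma ln_prod (I : finType) (f : I -> R) :
  (forall i, 0 < f i) -> ln (\prod_i f i) = \sum_i ln (f i).
Proof.
move=> f0; suff [_ ->] : 0 < \prod_i f i /\ ln (\prod_i f i) = \sum_i ln (f i) by [].
elim/big_rec2: _ => [|i x y _ [y0 E]]; first by rewrite ltr01 ln1.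
by rewrite mulr_gt0 // lnM ?posrE // E.
Qed.

End Gram.

Lemma sum_ltn_ord m k : (k <= m)%N -> (\sum_(i < m) (i < k))%N = k.
Proof.
move=> km; suff -> : (\sum_(i < m) (i < k))%N = minn m k by rewrite (minn_idPr km).
elim: m {km} => [|m IH]; first by rewrite big_ord0 min0n.
by rewrite big_ord_recr /= IH; case: (ltnP m k) => h /=; lia.
Qed.

Section Destabilized.
Variables (R : realType) (n m1 m2 : nat).

Lemma ln_det_gram m (g : 'M[R]_m) k (x : R) : g \in unitmx -> (k <= m)%N ->
  ln (\det (g^T *m diag_mx (\row_i expR (x * (i < k)%:R)) *m g)) =
  ln (\det g ^+ 2) + x * k%:R.
Proof.
move=> ug km; rewrite det_gram lnM ?posrE.
- rewrite ln_prod => [|i]; last by rewrite mxE expR_gt0.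
  under eq_bigr do rewrite mxE expRK.
  by rewrite -mulr_sumr -natr_sum sum_ltn_ord.
- by rewrite exprn_even_gt0 //= -unitfE -[_ \is a _]/(g \in unitmx).
- by apply: prodr_gt0 => i _; rewrite mxE expR_gt0.
Qed.

(** The rows of h extend a basis of the violating subspace, and the rows of g
    with index at least rank W vanish on its image W.  With weights exp x
    on the subspace and exp (- x) on its image, the entries of g Y_i h^T whose
    weight in the trace would grow with x are zero, whereas the sum of the
    log-determinants grows linearly in x. *)
Lemma not_expanding_unbounded (Y : 'I_n -> 'M[R]_(m1, m2)) :
  ~ expanding m2 m1 (fun i => (Y i)^T) -> loglik_unbounded Y.
Proof.
move=> nexp.
have [r [B ltB]] : exists r (B : 'M[R]_(r, m2)),
    (m2 * \rank (image_space B (fun i => (Y i)^T)) < m1 * \rank B)%N.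
  apply: contrapT => H; apply: nexp => r B; rewrite leqNgt; apply/negP => h.
  by apply: H; exists r, B.
set W := image_space _ _ in ltB.
pose h := row_ebase B; pose g := (invmx (row_ebase W))^T.
have uh : h \in unitmx by exact: row_ebase_unit.
have ug : g \in unitmx by rewrite unitmx_tr unitmx_inv row_ebase_unit.
have zero i (a : 'I_m1) (j : 'I_m2) : (\rank W <= a)%N -> (j < \rank B)%N ->
    (g *m Y i *m h^T) a j = 0.
  move=> Wa jB.
  have /submxP[D hD] : (row j h <= B)%MS.
    rewrite -[B in X in (_ <= X)%MS](mulmx_ebase B) -mulmxA.
    have fc : row_full (col_ebase B) by rewrite row_full_unit col_ebase_unit.
    rewrite (eqmxMfull _ fc).
    have jr : (j < r)%N by apply: leq_trans jB (rank_leq_row B).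
    have -> : row j h = row (Ordinal jr) ((pid_mx (\rank B) : 'M_(r, m2)) *m h).
      rewrite [RHS]row_mul [LHS]rowE; congr (mulmx _ h); apply/rowP => l; rewrite !mxE /= jB andbT.
      by rewrite eq_sym.
    exact: row_sub.
  have Wg : (row a g) *m W^T = 0.
    have WV : W *m invmx (row_ebase W) = col_ebase W *m pid_mx (\rank W).
      by rewrite -[RHS](mulmxK (row_ebase_unit W)) mulmx_ebase.
    apply: trmx_inj; rewrite trmx_mul trmxK trmx0 tr_row /g trmxK colE mulmxA WV -colE.
    apply/matrixP => x y; rewrite !mxE big1 // => l _; rewrite [X in _ * X]mxE.
    by case: eqP => [->|]; rewrite ?mulr0 //= ltnNge Wa mulr0.
  have : row a g *m (D *m (B *m (Y i)^T))^T = 0.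
    have /submxP[E ->] : (D *m (B *m (Y i)^T) <= W)%MS.
      apply: submx_trans (submxMl _ _) _; apply: (@sumsmx_sup _ _ i) => //.
      by rewrite genmxE.
    by rewrite trmx_mul mulmxA Wg mul0mx.
  rewrite mulmxA -hD trmx_mul trmxK mulmxA => /matrixP /(_ 0 0).
  rewrite -row_mul mxE [in RHS]mxE => E; rewrite -[RHS]E mxE; apply: eq_bigr => l _.
  by rewrite !mxE.
(* The trace at x = 0 bounds the trace at all x >= 0. *)
pose T0 := \sum_a \sum_j \sum_i (g *m Y i *m h^T) a j ^+ 2.
pose c0 := m2%:R * ln (\det g ^+ 2) + m1%:R * ln (\det h ^+ 2) - n%:R^-1 * T0.
suff lb x : 0 <= x -> exists2 y, [set loglik Y Psi1 Psi2 | Psi1 in PD R m1 & Psi2 in PD R m2]%classic y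
    & c0 + x <= y.
  move=> [M ubM]; have [|y Sy yM] := lb (`|M| + `|c0| + 1).
    by rewrite !addr_ge0.
  have := ubM _ Sy; rewrite leNgt => /negP; apply; apply: lt_le_trans yM.
  by have := ler_norm M; have := ler_norm (- c0); rewrite normrN; lra.
move=> x0; pose mu : 'rV[R]_m1 := \row_a expR (- x * (a < \rank W)%:R).
pose lam : 'rV[R]_m2 := \row_j expR (x * (j < \rank B)%:R).
exists (loglik Y (g^T *m diag_mx mu *m g) (h^T *m diag_mx lam *m h)).
  exists (g^T *m diag_mx mu *m g).
    by apply: PD_congr => //; apply: PD_diag => i; rewrite mxE expR_gt0.
  exists (h^T *m diag_mx lam *m h) => //.
  by apply: PD_congr => //; apply: PD_diag => i; rewrite mxE expR_gt0.
rewrite /loglik trace_gram_sum !ln_det_gram ?rank_leq_col //.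
have T0le : \sum_a \sum_j mu 0 a * lam 0 j * (\sum_i (g *m Y i *m h^T) a j ^+ 2) <= T0.
  apply: ler_sum => a _; apply: ler_sum => j _.
  have s0 : 0 <= \sum_i (g *m Y i *m h^T) a j ^+ 2 by apply: sumr_ge0 => i _; rewrite sqr_ge0.
  rewrite !mxE -expRD.
  case: (ltnP a (\rank W)) => aW; case: (ltnP j (\rank B)) => jB /=.
  - by rewrite !mulr1 addrC subrr expR0 mul1r.
  - rewrite mulr1 mulr0 addr0 ler_piMl // -[leRHS]expR0 ler_expR; lra.
  - by rewrite [\sum_i _]big1 ?mulr0 // => i _; rewrite zero // expr0n.
  - by rewrite !mulr0 addr0 expR0 mul1r.
have n0 : 0 <= n%:R^-1 :> R by rewrite invr_ge0 ler0n.
have key : x <= m1%:R * (x * (\rank B)%:R) - m2%:R * (x * (\rank W)%:R).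
  have : (1 + m2 * \rank W)%:R <= (m1 * \rank B)%:R :> R by rewrite ler_nat.
  rewrite natrD !natrM => H; have := ler_wpM2l x0 H; lra.
have := ler_wpM2l n0 T0le; rewrite /c0; lra.
Qed.

End Destabilized.

(** * Hall's marriage theorem *)

Section Hall.
Import mathcomp.boot.fintype mathcomp.boot.finset.
Variables (L S : finType) (E : L -> S -> bool) (y0 : S).

Definition neighbours (A : {set L}) : {set S} := [set y | [exists x in A, E x y]].

Lemma neighboursU A B : neighbours (A :|: B) = neighbours A :|: neighbours B.
Proof.
apply/setP => y; rewrite !inE; apply/existsP/orP => [[x]|].
  by rewrite inE => /andP[/orP[xA|xB] xy]; [left|right]; apply/existsP; exists x; apply/andP.
by case=> /existsP[x /andP[xA xy]]; exists x; rewrite inE xA ?orbT.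
Qed.

(** Induction on A.  If some nonempty proper subset B of A is tight, match B
    inside its neighbours and the rest of A outside them; otherwise match one
    element arbitrarily, which costs any set of other elements at most one
    neighbour. *)
Lemma hall_matching_in (A : {set L}) (D : {set S}) :
  (forall B : {set L}, B \subset A -> (#|B| <= #|neighbours B :&: D|)%N) ->
  exists f : L -> S, {in A &, injective f} /\ {in A, forall x, E x (f x) && (f x \in D)}.
Proof.
have [m mA] := ubnP #|A|; elim: m A D mA => // m IH A D /ltnSE mA H.
have [->|[x xA]] := set_0Vmem A.
  by exists (fun=> y0); split=> [x y|x]; rewrite inE.
have [/existsP[B /and4P[B0 BA BnA /eqP cB]]|/existsPn tight] := boolP [exists B : {set L},
    [&& B != set0, B \subset A, B != A & #|neighbours B :&: D| == #|B|]].
  have ltBA : (#|B| < #|A|)%N by rewrite proper_card // properEneq BnA.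
  have [B' B'B|f [fi fE]] := IH B (neighbours B :&: D) (leq_trans ltBA mA).
    have e : neighbours B' :&: neighbours B = neighbours B'.
      by apply/setIidPl; rewrite -(setUidPr B'B) neighboursU subsetUl.
    by rewrite setIA e; apply: H; exact: subset_trans B'B BA.
  have ltAB : (#|A :\: B| < #|A|)%N.
    by rewrite cardsD (setIidPr BA) -subn_gt0 subKn ?subset_leq_card // card_gt0.
  have [B' B'AB|g [gi gE]] := IH (A :\: B) (D :\: neighbours B) (leq_trans ltAB mA).
    have /H : B' :|: B \subset A by rewrite subUset BA (subset_trans B'AB) // subsetDl.
    rewrite neighboursU setIUl cardsU cardsU cB.
    have -> : B' :&: B = set0.
      by move: B'AB; rewrite subsetD -setI_eq0 => /andP[_ /eqP].
    rewrite cards0 subn0.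
    have -> : neighbours B' :&: (D :\: neighbours B) = (neighbours B' :&: D) :\: (neighbours B :&: D).
      apply/setP => y; rewrite !(in_setI, in_setD).
      by case: (y \in D); case: (y \in neighbours B); case: (y \in neighbours B').
    by rewrite cardsD; have := subset_leq_card (subsetIl (neighbours B' :&: D) (neighbours B :&: D)); lia.
  exists (fun x => if x \in B then f x else g x); split=> [x1 x2 x1A x2A|x1 x1A]; last first.
    case: ifPn => x1B; first by have := fE _ x1B; rewrite inE => /andP[-> /andP[_ ->]].
    have x1AB : x1 \in A :\: B by rewrite inE x1B.
    by have := gE _ x1AB; rewrite inE => /andP[-> /andP[_ ->]].
  case: ifPn => x1B; case: ifPn => x2B; first exact: fi.
  - have x2AB : x2 \in A :\: B by rewrite inE x2B.
    have := fE _ x1B; have := gE _ x2AB; rewrite !inE => /andP[_ /andP[h _]] /andP[_ /andP[h' _]] e.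
    by rewrite -e h' in h.
  - have x1AB : x1 \in A :\: B by rewrite inE x1B.
    have := fE _ x2B; have := gE _ x1AB; rewrite !inE => /andP[_ /andP[h _]] /andP[_ /andP[h' _]] e.
    by rewrite e h' in h.
  - by apply: gi; rewrite inE ?x1B ?x2B.
have [y] : exists y, y \in neighbours [set x] :&: D.
  by apply/card_gt0P; apply: leq_trans (H _ _); rewrite ?cards1 ?sub1set.
rewrite !inE => /andP[/existsP[x' /andP[/set1P -> xy]] yD].
have ltA : (#|A :\ x| < #|A|)%N by rewrite [ltnRHS](cardsD1 x) xA.
have [B BA|f [fi fE]] := IH (A :\ x) (D :\ y) (leq_trans ltA mA).
  have [->|B0] := eqVneq B set0; first by rewrite cards0.
  have BA' : B \subset A by rewrite (subset_trans BA) // subsetDl.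
  have := tight B; rewrite B0 BA' /= negb_and negbK => /orP[/eqP e|ne].
    by have := subsetP BA x; rewrite e xA !inE eqxx => /(_ isT).
  have := H B BA'; rewrite leq_eqVlt eq_sym (negPf ne) /= => lt.
  rewrite setIDA cardsD -ltnS (leq_trans lt) //.
  have := subset_leq_card (subsetIr (neighbours B :&: D) [set y]); rewrite cards1; lia.
exists (fun z => if z == x then y else f z); split=> [x1 x2 x1A x2A|x1 x1A]; last first.
  case: eqP => [->|/eqP n1]; first by rewrite xy.
  by have := fE x1; rewrite !inE n1 x1A => /(_ isT) /and3P[-> _ ->].
case: eqP => [->|/eqP n1]; case: eqP => [->|/eqP n2] // e.
- by have := fE x2; rewrite !inE n2 x2A -e eqxx andbF => /(_ isT).
- by have := fE x1; rewrite !inE n1 x1A e eqxx andbF => /(_ isT).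
- by apply: fi => //; rewrite !inE ?n1 ?n2.
Qed.

Lemma hall_matching :
  (forall B : {set L}, (#|B| <= #|neighbours B|)%N) ->
  exists f : L -> S, injective f /\ forall x, E x (f x).
Proof.
move=> H; have [B _|f [fi fE]] := @hall_matching_in setT setT; first by rewrite setIT.
by exists f; split=> [x y|x]; [apply: fi | case/andP: (fE x (in_setT x))].
Qed.

End Hall.

(** * Pivoted LDL factorization *)

Section LDL.
Variable R : realType.

Lemma PD_diag_gt0 m (P : 'M[R]_m) i : PD R m P -> 0 < P i i.
Proof.
move=> [_ /(_ (delta_mx i 0))].
rewrite trmx_delta -rowE -colE !mxE; apply.
by apply/eqP => /matrixP /(_ i 0); rewrite !mxE !eqxx => /eqP; rewrite oner_eq0.
Qed.

Lemma PD_dr m p (P : 'M[R]_m) (Q : 'M[R]_p) :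
  PD R (m + p) (block_mx P 0 0 Q) -> PD R p Q.
Proof.
move=> [Ps Pp]; split.
  by move: Ps; rewrite tr_block_mx => /eq_block_mx[].
move=> v v0; have := Pp (col_mx 0 v).
rewrite tr_col_mx mul_row_block mul_row_col trmx0 !(mulmx0, mul0mx, add0r, addr0); apply.
by apply: contraNneq v0 => /(congr1 dsubmx); rewrite col_mxKd linear0 => ->.
Qed.

(** Pivoting on the largest diagonal entry p keeps the entries of u in [-1, 1]:
    the new column l of u satisfies p l_i^2 < Q_ii <= p because the Schur
    complement has a positive diagonal. *)
Lemma pivoted_LDL m (P : 'M[R]_m) : PD R m P ->
  exists (u : 'M[R]_m) (lam : 'rV[R]_m),
  [/\ forall i j, `|u i j| <= 1, \det u ^+ 2 = 1, forall i, 0 < lam 0 i &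
      P = u *m diag_mx lam *m u^T].
Proof.
elim: m P => [|m IH] P PP.
  exists 0, 0; split; first by case.
  - by rewrite det_mx00 expr1n.
  - by case.
  - by apply/matrixP; case.
have [i0 _ maxP] := @arg_maxP _ _ _ (ord0 : 'I_m.+1) xpredT (fun i => P i i) isT.
pose s := tperm 0 i0.
pose Q := (perm_mx s)^T *m P *m perm_mx s.
have QE i j : Q i j = P (s i) (s j).
  have sV : (s^-1)%g = s by exact: tpermV.
  have colP (A : 'M[R]_m.+1) : A *m perm_mx s = col_perm s A by rewrite col_permE sV.
  by rewrite /Q tr_perm_mx colP -row_permE sV !mxE.
have PQ : PD R (1 + m) Q by apply: PD_congr => //; exact: unitmx_perm.
have PE : P = perm_mx s *m Q *m (perm_mx s)^T.
  rewrite /Q tr_perm_mx !mulmxA -perm_mxM mulgV perm_mx1 mul1mx -mulmxA -perm_mxM.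
  by rewrite mulgV perm_mx1 mulmx1.
clearbody Q; pose p := Q 0 0; have p0 : 0 < p by exact: PD_diag_gt0.
have Qmax i : Q i i <= p by rewrite /p !QE tpermL; exact: maxP.
pose l := p^-1 *: dlsubmx (Q : 'M_(1 + m)).
pose T := drsubmx (Q : 'M_(1 + m)) - p *: (l *m l^T).
pose w : 'M[R]_(1 + m) := block_mx 1%:M 0 l 1%:M.
have ulE : ulsubmx (Q : 'M_(1 + m)) = p%:M.
  by apply/matrixP => i j; rewrite !ord1 !mxE !lshift0 eqxx.
have dlE : dlsubmx (Q : 'M_(1 + m)) = p *: l by rewrite /l scalerA divff ?scale1r // gt_eqF.
have urE : ursubmx (Q : 'M_(1 + m)) = p *: l^T.
  rewrite -linearZ /= -dlE; case: PQ => Qs _.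
  by rewrite -[in LHS]Qs -trmx_dlsub.
have QwE : Q = w *m block_mx p%:M 0 0 T *m w^T.
  have -> : w *m block_mx p%:M 0 0 T *m w^T =
      block_mx p%:M (p *: l^T) (p *: l) (p *: (l *m l^T) + T).
    rewrite /w tr_block_mx !mulmx_block.
    rewrite !trmx1 !trmx0 !(mul1mx, mulmx1, mul0mx, mulmx0, addr0, add0r).
    by rewrite mul_scalar_mx mul_mx_scalar -scalemxAl.
  by rewrite /T addrCA subrr addr0 -ulE -dlE -urE submxK.
have uw : w \in unitmx by rewrite unitmxE det_lblock !det1 mulr1 unitr1.
have PT : PD R m T.
  apply: (@PD_dr 1 _ p%:M).
  have -> : block_mx p%:M 0 0 T = (invmx w^T)^T *m Q *m invmx w^T.
    rewrite QwE trmx_inv trmxK -!mulmxA mulmxV ?unitmx_tr //.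
    by rewrite mulmx1 mulKmx.
  by apply: PD_congr => //; rewrite unitmx_inv unitmx_tr.
have [u [lam [ub du lam0 TE]]] := IH T PT.
have lb i : `|l i 0| <= 1.
  have Tii : T i i = Q (rshift 1 i) (rshift 1 i) - p * (l i 0 * l i 0).
    by rewrite /T !mxE big_ord1 !mxE.
  have := PD_diag_gt0 i PT; rewrite Tii.
  have := Qmax (rshift 1 i); move: (Q _ _) => q qp h.
  have : p * (l i 0 * l i 0) < p * 1 by lra.
  by rewrite ltr_pM2l // -expr2 -real_normK ?num_real // expr_lt1 // => /ltW.
have lam1 : forall i : 'I_(1 + m), 0 < row_mx (p%:M : 'M_1) lam 0 i.
  move=> i; case: (split_ordP i) => i' ->; rewrite ?row_mxEl ?row_mxEr //.
  by rewrite (ord1 i') mxE eqxx.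
exists (perm_mx s *m (w *m block_mx 1%:M 0 0 u)), (row_mx (p%:M : 'M_1) lam); split.
- have bnd i j : `|(w *m block_mx 1%:M 0 0 u : 'M_(1 + m)) i j| <= 1.
    rewrite /w mulmx_block !(mul1mx, mulmx1, mul0mx, mulmx0, addr0, add0r).
    case: (@split_ordP 1 m i) => i' ->; case: (@split_ordP 1 m j) => j' ->.
    + by rewrite block_mxEul mxE; case: eqP; rewrite ?normr1 ?normr0 ?ler01.
    + by rewrite block_mxEur mxE normr0 ler01.
    + by rewrite block_mxEdl ord1 lb.
    + by rewrite block_mxEdr ub.
  by move=> i j; rewrite -row_permE mxE; exact: bnd.
- have dw : \det w = 1 by rewrite det_lblock !det1 mulr1.
  have dwu : \det (w *m block_mx 1%:M 0 0 u : 'M_(1 + m)) = \det u.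
    by rewrite det_mulmx dw det_lblock det1 !mul1r.
  rewrite det_mulmx det_perm dwu exprMn du mulr1.
  by rewrite -exprM mulnC exprM sqrrN expr1n expr1n.
- exact: lam1.
have mid : block_mx p%:M 0 0 T =
    block_mx 1%:M 0 0 u *m diag_mx (row_mx (p%:M : 'M_1) lam) *m (block_mx 1%:M 0 0 u)^T
    :> 'M_(1 + m).
  rewrite diag_mx_row tr_block_mx !mulmx_block !trmx0 trmx1.
  rewrite !(mul1mx, mulmx1, mul0mx, mulmx0, addr0, add0r) -TE.
  by congr block_mx; apply/matrixP => i j; rewrite !ord1 !mxE.
by rewrite PE QwE mid !trmx_mul !mulmxA.
Qed.

End LDL.

(** * Expanding tuples have bounded likelihood *)

Section Continuity.
Variables (R : realType) (T : topologicalType).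

Lemma continuous_sumr (I : finType) (P : pred I) (f : I -> T -> R) :
  (forall i, continuous (f i)) -> continuous (fun x => \sum_(i | P i) f i x).
Proof.
by move=> cf; apply: continuous_big => [|i _]; [exact: add_continuous | exact: cf].
Qed.

Lemma continuous_prodr (I : finType) (P : pred I) (f : I -> T -> R) :
  (forall i, continuous (f i)) -> continuous (fun x => \prod_(i | P i) f i x).
Proof.
by move=> cf; apply: continuous_big => [|i _]; [exact: mul_continuous | exact: cf].
Qed.

Lemma continuous_mulr (f g : T -> R) :
  continuous f -> continuous g -> continuous (fun x => f x * g x).
Proof. by move=> cf cg x; apply: continuousM; [exact: cf | exact: cg]. Qed.

Lemma continuous_mulmx m n p (A : T -> 'M[R]_(m, n)) (B : T -> 'M[R]_(n, p)) :
  (forall i j, continuous (fun x => A x i j)) -> (forall i j, continuous (fun x => B x i j)) ->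
  forall i j, continuous (fun x => (A x *m B x) i j).
Proof.
move=> cA cB i j; under eq_fun do rewrite mxE.
by apply: continuous_sumr => k; apply: continuous_mulr.
Qed.

Lemma continuous_det m (A : T -> 'M[R]_m) :
  (forall i j, continuous (fun x => A x i j)) -> continuous (fun x => \det (A x)).
Proof.
move=> cA; apply: continuous_sumr => s; apply: continuous_mulr; first exact: cst_continuous.
by apply: continuous_prodr => i.
Qed.

End Continuity.

Section Expanding.
Import mathcomp.boot.fintype mathcomp.boot.finset.
Variables (R : realType) (n m1 m2 : nat) (Y : 'I_n -> 'M[R]_(m1, m2)).

(** The coefficient of mu_a lam_j in the trace term, see [trace_gram_sum]. *)
Definition weight (g : 'M[R]_m1) (h : 'M[R]_m2) a j := \sum_i (g *m Y i *m h^T) a j ^+ 2.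

Lemma weight_ge0 g h a j : 0 <= weight g h a j.
Proof. by apply: sumr_ge0 => i _; rewrite sqr_ge0. Qed.

(** Each column index j has m1 copies and each row index a has m2 copies, so that
    a perfect matching uses every mu_a exactly m2 times and every lam_j exactly
    m1 times, as the log-determinants do. *)
Definition matching_weight g h (s : {ffun 'I_m2 * 'I_m1 -> 'I_m1 * 'I_m2}) :=
  \prod_x weight g h (s x).1 x.1.

(** Summing over all matchings gives a continuous function of g and h that is
    positive as soon as one matching has positive weight. *)
Definition total_matching_weight g h :=
  \sum_(s : {ffun 'I_m2 * 'I_m1 -> 'I_m1 * 'I_m2} | injectiveb s) matching_weight g h s.

Lemma rank_diag_indicator m (A : {set 'I_m}) :
  (#|A| <= \rank (diag_mx (\row_i (i \in A)%:R) : 'M[R]_m))%N.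
Proof.
pose E : 'M[R]_(#|A|, m) := \matrix_(i, j) (enum_val i == j)%:R.
apply: (@rank_corner_det _ _ _ _ _ E E^T).
suff -> : E *m diag_mx (\row_i (i \in A)%:R) *m E^T = 1%:M by rewrite det1 oner_eq0.
apply/matrixP => i j; rewrite mul_mx_diag !mxE (bigD1 (enum_val i)) //= !mxE eqxx enum_valP.
rewrite big1 ?addr0 => [|l /negPf li]; last by rewrite !mxE eq_sym li !mul0r.
by rewrite !mul1r eq_sym (inj_eq enum_val_inj).
Qed.

(** For a set J of columns, the entries of g Y_i h^T in columns J vanish outside
    the rows NJ adjacent to J, so the span of the J-rows of h is mapped into
    a space of dimension at most #|NJ|; expansion is then Hall's condition. *)
Lemma expanding_matching g h :
  (0 < m1)%N -> (0 < m2)%N -> g \in unitmx -> h \in unitmx ->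
  expanding m2 m1 (fun i => (Y i)^T) ->
  exists s : {ffun 'I_m2 * 'I_m1 -> 'I_m1 * 'I_m2},
    injectiveb s /\ 0 < matching_weight g h s.
Proof.
move=> m10 m20 ug uh eY.
pose E (x : 'I_m2 * 'I_m1) (y : 'I_m1 * 'I_m2) := weight g h y.1 x.1 != 0.
have [B|f [fi fE]] := hall_matching (E := E) (Ordinal m10, Ordinal m20); last first.
  exists [ffun x => f x]; split.
    by apply/injectiveP => x y; rewrite !ffunE; exact: fi.
  by apply: prodr_gt0 => x _; rewrite ffunE lt0r weight_ge0 andbT; exact: fE.
pose J := [set x.1 | x in B].
pose NJ := [set a | [exists j in J, weight g h a j != 0]].
have leB : (#|B| <= m1 * #|J|)%N.
  apply: leq_trans (_ : #|finset.setX J [set: 'I_m1]| <= _)%N.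
    apply: subset_leq_card; apply/fintype.subsetP => x xB; rewrite inE in_setT andbT.
    by apply/imsetP; exists x.
  by rewrite cardsX cardsT card_ord mulnC.
have leN : (m2 * #|NJ| <= #|neighbours E B|)%N.
  apply: leq_trans (_ : _ <= #|finset.setX NJ [set: 'I_m2]|)%N _.
    by rewrite cardsX cardsT card_ord mulnC.
  apply: subset_leq_card; apply/fintype.subsetP => -[a c]; rewrite !inE /= andbT.
  move=> /existsP[j /andP[/imsetP[x xB ->] wE]].
  by apply/existsP; exists x; rewrite xB.
apply: leq_trans leB (leq_trans _ leN).
pose DJ : 'M[R]_m2 := diag_mx (\row_i (i \in J)%:R).
pose DN : 'M[R]_m1 := diag_mx (\row_i (i \in ~: NJ)%:R).
have := eY _ (DJ *m h); rewrite mxrankMfree ?row_free_unit // => le1.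
apply: leq_trans (leq_mul (leqnn _) (rank_diag_indicator J)) (leq_trans le1 _).
rewrite leq_mul2l; apply/orP; right.
have : (image_space (DJ *m h) (fun i => (Y i)^T) <= kermx (g^T *m DN))%MS.
  apply/sumsmx_subP => i _; rewrite genmxE; apply/sub_kermxP.
  suff -> : DJ *m h *m (Y i)^T *m (g^T *m DN) = DJ *m (g *m Y i *m h^T)^T *m DN.
    apply/matrixP => j a; rewrite mul_mx_diag mul_diag_mx !mxE.
    case: (boolP (j \in J)) => jJ; rewrite ?mul0r // mul1r in_setC.
    case: (boolP (a \in NJ)) => aN; rewrite ?mulr0 // mulr1.
    move: aN; rewrite inE => /existsPn /(_ j); rewrite jJ negbK => /eqP w0.
    apply/eqP; rewrite -sqrf_eq0; apply/eqP.
    have := psumr_eq0P (fun i _ => sqr_ge0 ((g *m Y i *m h^T) a j)) w0 => /(_ i isT).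
    by rewrite [in (_ *m h^T) a j]mxE.
  by rewrite !trmx_mul trmxK !mulmxA.
move=> /mxrankS; rewrite mxrank_ker => le2; apply: leq_trans le2 _.
rewrite -[\rank _]mxrank_tr trmx_mul trmxK mxrankMfree ?row_free_unit // mxrank_tr.
have := rank_diag_indicator (~: NJ); rewrite -/DN.
have := cardsC NJ; rewrite card_ord => e le3.
by rewrite leq_subLR -[leqLHS]e [leqLHS]addnC leq_add2r.
Qed.

Lemma total_matching_weight_gt0 g h :
  (0 < m1)%N -> (0 < m2)%N -> g \in unitmx -> h \in unitmx ->
  expanding m2 m1 (fun i => (Y i)^T) -> 0 < total_matching_weight g h.
Proof.
move=> m10 m20 ug uh eY; have [s [si s0]] := expanding_matching m10 m20 ug uh eY.
rewrite /total_matching_weight (bigD1 s) //= ltr_pwDl // sumr_ge0 // => t _.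
by apply: prodr_ge0 => x _; exact: weight_ge0.
Qed.

(** The pairs (g, h) with entries in [-1, 1] and determinants of square 1 form
    a compact set on which the total weight is continuous and positive. *)
Lemma total_matching_weight_bounded_below :
  (0 < m1)%N -> (0 < m2)%N -> expanding m2 m1 (fun i => (Y i)^T) ->
  exists2 d : R, 0 < d & forall (g : 'M[R]_m1) (h : 'M[R]_m2),
    (forall i j, `|g i j| <= 1) -> (forall i j, `|h i j| <= 1) ->
    \det g ^+ 2 = 1 -> \det h ^+ 2 = 1 -> d <= total_matching_weight g h.
Proof.
move=> m10 m20 eY.
pose G (z : 'rV[R]_(m1 * m1 + m2 * m2)) : 'M[R]_m1 := vec_mx (lsubmx z).
pose H (z : 'rV[R]_(m1 * m1 + m2 * m2)) : 'M[R]_m2 := vec_mx (rsubmx z).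
have cG i j : continuous (fun z => G z i j).
  by rewrite /G; under eq_fun do rewrite !mxE; exact: coord_continuous.
have cH i j : continuous (fun z => H z i j).
  by rewrite /H; under eq_fun do rewrite !mxE; exact: coord_continuous.
pose box := [set z : 'rV[R]_(m1 * m1 + m2 * m2) | forall k, `[(-1 : R), 1]%classic (z ord0 k)]%classic.
pose sq1 m (D : 'rV[R]_(m1 * m1 + m2 * m2) -> 'M[R]_m) :=
  ((fun z => \det (D z) * \det (D z)) @^-1` [set x | x = 1])%classic.
have csq m (D : 'rV[R]_(m1 * m1 + m2 * m2) -> 'M[R]_m) :
    (forall i j, continuous (fun z => D z i j)) -> closed (sq1 m D).
  move=> cD; apply: preimage_closed; last exact: closed_eq.
  by move=> z _; apply: (continuous_mulr (continuous_det cD) (continuous_det cD)).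
pose C := (box `&` (sq1 m1 G `&` sq1 m2 H))%classic.
have cptbox : compact box.
  by apply: (@rV_compact _ _ (fun=> `[(-1 : R), 1]%classic)) => k; exact: segment_compact.
have cptC : compact C by apply: compact_closedI => //; apply: closedI; exact: csq.
have C0 : (C !=set0)%classic.
  exists (row_mx (mxvec 1%:M) (mxvec 1%:M)); split; last first.
    by split; rewrite /sq1 /= /G /H ?row_mxKl ?row_mxKr mxvecK det1 mulr1.
  move=> k /=; rewrite in_itv /= -ler_norml.
  by case: (split_ordP k) => k' ->; rewrite ?row_mxEl ?row_mxEr;
    case/mxvec_indexP: k' => i j; rewrite mxvecE mxE; case: eqP; rewrite ?normr1 ?normr0.
have cf : continuous (fun z => total_matching_weight (G z) (H z)).
  apply: continuous_sumr => s; apply: continuous_prodr => x; apply: continuous_sumr => i.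
  have cM := continuous_mulmx (continuous_mulmx cG (B := fun=> Y i) (fun _ _ => @cst_continuous _ _ _))
    (B := fun z => (H z)^T).
  by apply: continuous_mulr; apply: cM => k l; under eq_fun do rewrite mxE; exact: cH.
have [z /set_mem [_ [Gz Hz]] minz] := EVT_min_rV C0 cptC (continuous_subspaceT cf).
have unit m (D : 'M[R]_m) : \det D * \det D = 1 -> D \in unitmx.
  by move=> h; rewrite unitmxE unitfE; apply: contra_eq_neq h => ->; rewrite mul0r eq_sym oner_eq0.
exists (total_matching_weight (G z) (H z)).
  by apply: total_matching_weight_gt0 => //; apply: unit.
move=> g h gb hb dg dh; have := minz (row_mx (mxvec g) (mxvec h)).
rewrite /G /H row_mxKl row_mxKr !mxvecK; apply; apply/mem_set; split; last first.
  by split; rewrite /sq1 /= /G /H ?row_mxKl ?row_mxKr mxvecK -expr2.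
move=> k /=; rewrite in_itv /= -ler_norml.
by case: (split_ordP k) => k' ->; rewrite ?row_mxEl ?row_mxEr;
  case/mxvec_indexP: k' => i j; rewrite mxvecE.
Qed.

(** The tangent line of the logarithm at 1 / k. *)
Lemma ln_le_lin (x k : R) : 0 < x -> 0 < k -> ln x <= k * x - 1 - ln k.
Proof.
move=> x0 k0; have kx : 0 < k * x by exact: mulr_gt0.
rewrite lerBrDr -lnM ?posrE // mulrC.
have := @le_ln1Dx R (k * x - 1).
rewrite (_ : 1 + (k * x - 1) = k * x); last by ring.
by apply; lra.
Qed.

(** Along a matching of weight at least c the logarithms of mu_a lam_j are bounded
    by [ln_le_lin], whose linear terms are absorbed by the trace and whose
    constants add up to the logarithm of the weight of the matching. *)
Lemma expanding_bounded :
  (0 < m1)%N -> (0 < m2)%N -> (0 < n)%N -> expanding m2 m1 (fun i => (Y i)^T) ->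
  ~ loglik_unbounded Y.
Proof.
move=> m10 m20 n0 eY; apply; have [d d0 Hd] := total_matching_weight_bounded_below m10 m20 eY.
pose t := #|{: {ffun 'I_m2 * 'I_m1 -> 'I_m1 * 'I_m2}}|.
have t0 : (0 : R) < t%:R.
  by rewrite ltr0n; apply/card_gt0P; exists [ffun=> (Ordinal m10, Ordinal m20)].
(* The factor 2 gives a strict inequality when bounding the sum of all matchings. *)
pose c : R := d / (2 * t%:R); have c0 : 0 < c by rewrite divr_gt0 // mulr_gt0.
(* A pair (a, j) may be matched by up to m1 copies of j; the slope k makes the
   linear bounds add up to at most the trace term. *)
pose k : R := n%:R^-1 / m1%:R.
have k0 : 0 < k by rewrite divr_gt0 ?invr_gt0 // ltr0n.
exists (- (1 + ln k) * (m2 * m1)%:R - ln c) => _ [P1 PP1 [P2 PP2 <-]].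
have [u [mu [ub du mu0 P1E]]] := pivoted_LDL PP1.
have [v [lam [vb dv lam0 P2E]]] := pivoted_LDL PP2.
have dW : d <= total_matching_weight u^T v^T.
  by apply: Hd; rewrite ?det_tr // => i j; rewrite mxE.
have [s si ds] : exists2 s : {ffun 'I_m2 * 'I_m1 -> 'I_m1 * 'I_m2}, injective s & c <= matching_weight u^T v^T s.
  apply: contrapT => H; move: dW; rewrite leNgt => /negP; apply.
  apply: (@le_lt_trans _ _ (\sum_(s : {ffun 'I_m2 * 'I_m1 -> 'I_m1 * 'I_m2}) c)); last first.
    rewrite sumr_const -[#|_|]/t -mulr_natr /c invfM mulrA mulfVK ?gt_eqF //; lra.
  rewrite /total_matching_weight big_mkcond; apply: ler_sum => s _.
  case: ifPn => [/injectiveP si|_]; last exact: ltW.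
  by rewrite leNgt; apply/negP => /ltW h; apply: H; exists s.
have W0 x : 0 < weight u^T v^T (s x).1 x.1.
  rewrite lt0r weight_ge0 andbT; apply: contraTneq (lt_le_trans c0 ds) => Wx.
  by rewrite /matching_weight (bigD1 x) //= Wx mul0r ltxx.
have P1G : P1 = (u^T)^T *m diag_mx mu *m u^T by rewrite trmxK.
have P2G : P2 = (v^T)^T *m diag_mx lam *m v^T by rewrite trmxK.
rewrite /loglik P1G P2G !det_gram !det_tr du dv !mul1r !ln_prod // trace_gram_sum.
have sbij : bijective s by apply: inj_card_bij => //; rewrite !card_prod mulnC.
(* The matching redistributes the log-determinants over products mu_a lam_j. *)
have lnE : m2%:R * (\sum_a ln (mu 0 a)) + m1%:R * (\sum_j ln (lam 0 j)) =
    \sum_x ln (mu 0 (s x).1 * lam 0 x.1).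
  under [RHS]eq_bigr do rewrite lnM ?posrE //.
  rewrite big_split /=; congr (_ + _).
    rewrite -(reindex s (onW_bij _ sbij) (P := xpredT) (F := fun y => ln (mu 0 y.1))).
    rewrite -(pair_bigA _ (fun a _ => ln (mu 0 a))) /= mulr_sumr; apply: eq_bigr => a _.
    by rewrite sumr_const card_ord mulr_natl.
  rewrite -(pair_bigA _ (fun j _ => ln (lam 0 j))) /= mulr_sumr; apply: eq_bigr => a _.
  by rewrite sumr_const card_ord mulr_natl.
rewrite lnE.
have le1 : \sum_x ln (mu 0 (s x).1 * lam 0 x.1) <=
    \sum_(x : 'I_m2 * 'I_m1) (k * (weight u^T v^T (s x).1 x.1 * (mu 0 (s x).1 * lam 0 x.1))
      - (1 + ln k) - ln (weight u^T v^T (s x).1 x.1)).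
  apply: ler_sum => x _.
  have := ln_le_lin (mulr_gt0 (mu0 (s x).1) (lam0 x.1)) (mulr_gt0 k0 (W0 x)).
  have -> : ln (k * weight u^T v^T (s x).1 x.1) = ln k + ln (weight u^T v^T (s x).1 x.1).
    by rewrite lnM ?posrE.
  by rewrite -mulrA; lra.
apply: le_trans (lerD le1 (lexx _)) _; rewrite !sumrB.
rewrite -(ln_prod W0) -[\prod_x _]/(matching_weight _ _ _) sumr_const card_prod !card_ord.
have le2 : ln c <= ln (matching_weight u^T v^T s).
  by rewrite ler_ln ?posrE // (lt_le_trans c0).
have le3 : \sum_(x : 'I_m2 * 'I_m1) k * (weight u^T v^T (s x).1 x.1 * (mu 0 (s x).1 * lam 0 x.1))
   <= n%:R^-1 * \sum_a \sum_j mu 0 a * lam 0 j * (\sum_i (u^T *m Y i *m (v^T)^T) a j ^+ 2).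
  have term0 a j : 0 <= mu 0 a * lam 0 j * (\sum_i (u^T *m Y i *m (v^T)^T) a j ^+ 2).
    by rewrite !mulr_ge0 ?(ltW (mu0 _)) ?(ltW (lam0 _)) // weight_ge0.
  rewrite [leLHS](_ : _ = \sum_j \sum_l k *
    (weight u^T v^T (s (j, l)).1 j * (mu 0 (s (j, l)).1 * lam 0 j))); last first.
    by rewrite pair_bigA; apply: eq_bigr => -[].
  rewrite [X in _ <= _ * X]exchange_big /= mulr_sumr.
  apply: ler_sum => j _.
  apply: (@le_trans _ _ (\sum_(l < m1) k * \sum_a mu 0 a * lam 0 j *
     (\sum_i (u^T *m Y i *m (v^T)^T) a j ^+ 2))).
    apply: ler_sum => l _; rewrite ler_wpM2l ?(ltW k0) //.
    rewrite (bigD1 (s (j, l)).1) //= mulrC lerDl; exact: sumr_ge0.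
  by rewrite sumr_const card_ord -[_ *+ m1]mulr_natl mulrA /k [m1%:R * _]mulrC divfK // pnatr_eq0 -lt0n.
rewrite -mulr_natr; lra.
Qed.

End Expanding.

(** * The criterion *)

Lemma ceil_pred_natP (m1 m2 k l : nat) : (0 < m2)%N ->
  l%:Z = Num.ceil (m1%:Q / m2%:Q * k%:Q) - 1 <->
  (m2 * l < m1 * k)%N && (m1 * k <= m2 * l.+1)%N.
Proof.
move=> m20; have m2Q : 0 < m2%:Q by rewrite ltr0n.
have E : (m2 * l < m1 * k)%N && (m1 * k <= m2 * l.+1)%N =
  (l%:Q < m1%:Q / m2%:Q * k%:Q <= l.+1%:Q).
  rewrite mulrAC ltr_pdivlMr // ler_pdivrMr // -!natrM ltr_nat ler_nat.
  by rewrite [(l * m2)%N]mulnC [(l.+1 * m2)%N]mulnC.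
have {}E : (m2 * l < m1 * k)%N && (m1 * k <= m2 * l.+1)%N =
    (Num.ceil (m1%:Q / m2%:Q * k%:Q) == l.+1%:Z).
  have e : l.+1%:Z - 1 = l%:Z by lia.
  by rewrite E ceil_eq e.
rewrite E; move: (Num.ceil _) => c; split=> [lc|/eqP ->]; first by apply/eqP; lia.
by lia.
Qed.

Theorem theorem4p8 (R : realType) (m1 m2 n : nat)
    (hm2 : (0 < m2)%N) (hm21 : (m2 <= m1)%N) (hm1 : (m1 <= n * m2)%N) :
  (forall Y : 'I_n -> 'M[R]_(m1, m2), loglik_unbounded Y) <->
  (exists k l : nat,
     [/\ (1 <= k <= m2)%N,
         l%:Z = Num.ceil (m1%:Q / m2%:Q * k%:Q) - 1,
         (m1 - l <= n * (m2 - k))%N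
       & cp R n (m2 - k) k (m1 - l) (n * k - l) = ((m1 - l) * (n * k - l))%N]).
Proof.
have m10 : (0 < m1)%N by apply: leq_trans hm21.
have n0 : (0 < n)%N.
  by rewrite lt0n; apply: contraTneq hm1 => ->; rewrite mul0n -ltnNge.
have lt_l k l : (k <= m2)%N -> (m2 * l < m1 * k)%N -> (l < m1)%N /\ (l < n * k)%N.
  move=> km lt; split; rewrite -(ltn_pmul2l hm2); apply: leq_trans lt _.
    by rewrite [leqRHS]mulnC leq_mul2l km orbT.
  by rewrite mulnA [(m2 * n)%N]mulnC leq_mul2r hm1 orbT.
split=> [unb|[k [l [/andP[k1 km] /(ceil_pred_natP _ _ _ hm2)/andP[lt ge] _ /cp_fullP[X [Z XZ]]]]] Y].
  have [|k [l [/andP[k1 km] lt ge [X [Z XZ]]]]] :=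
    @not_expanding_tens R n m1 m2 (pchar_num R) _ hm1.
    by move=> Y /(expanding_bounded m10 hm2 n0); apply; exact: unb.
  have [lm lnk] := lt_l k l km lt.
  exists k, l; split; first by rewrite k1.
  - by apply/ceil_pred_natP => //; rewrite lt.
  - have := tens_row_free_left _ XZ; rewrite subn_gt0 => /(_ lnk) /eqP <-.
    by rewrite (leq_trans (rank_leq_col _)) // sum_nat_const card_ord.
  - by apply/cp_fullP; exists X, Z.
have [lm lnk] := lt_l k l km lt.
have [||P PX] := @tens_tangent_onto R n l (m1 - l) k (m2 - k) (n * k - l) X Z _ _ XZ.
- by rewrite subn_gt0.
- by rewrite subnK // ltnW.
apply: not_expanding_unbounded.
have Rinf : has_nonroots R by apply: pchar0_has_nonroots; exact: pchar_num.
have gen m1' m2' : (l + (m1 - l))%N = m1' -> (k + (m2 - k))%N = m2' ->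
    forall Y' : 'I_n -> 'M[R]_(m1', m2'), (m2' * l < m1' * k)%N ->
    ~ expanding m2' m1' (fun i => (Y' i)^T).
  by move=> <- <- Y' lt'; exact: tangent_onto_not_expanding Rinf PX lt'.
by apply: gen; rewrite ?subnKC // ltnW.
Qed.
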